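(* Let $p\ge5$ be a prime and $\ell_p=(p-1)/2$. The vector of normalized Mordell–Appell integrals $\mathcal L^{(p)}(t)=(\mathcal L^{(p)}_1(t),\dots,\mathcal L^{(p)}_{\ell_p}(t))^T$ is a vector-valued modular form of weight $1/2$, transforming under the modular $S$ transformation $\tau\to-1/\tau$ ($t\to\pi^2/t$) as $$\mathcal L^{(p)}(t)=\sqrt{\frac{\pi}{t}}\;M^{(p)}\,\mathcal L^{(p)}\!\left(\frac{\pi^2}{t}\right).$$ Here $M^{(p)}$ is an $\ell_p\times\ell_p$ mixing matrix, with entries $$M^{(p)}_{jk}=\frac{2}{\sqrt p}\,(-1)^{j+k+\lfloor\frac{p+3}{6}\rfloor}\sin\left(\frac{6jk\pi}{p}\right).$$
   Context: $t=-\pi i\tau$ with $\Im\tau>0$, i.e. $\Re t>0$. For $\Re t>0$, $JS_{(P,a)}(t)=\frac1t\int_0^\infty e^{-Pu^2/t}\,\frac{\sinh((P-a)u)}{\sinh(Pu)}\,du$, $1\le a\le 2P-1$. For $1\le j\le\ell_p$, $$\mathcal L^{(p)}_j(t)=\sqrt{\frac{48pt}{\pi}}\Bigl[\mathrm{sign}(6j-p)\,JS_{(12p,|12j-2p|)}(t)+JS_{(12p,14p-12j)}(t)+JS_{(12p,12j+2p)}(t)+JS_{(12p,10p-12j)}(t)\Bigr].$$ *)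

(* Defs.v *)
From HB Require Import structures.
From mathcomp Require Export all_boot all_order all_algebra.
From mathcomp Require Export all_classical all_reals all_analysis.
From mathcomp Require Export complex.

Set Implicit Arguments.
Unset Strict Implicit.
Unset Printing Implicit Defensive.

Export Order.TTheory GRing.Theory Num.Theory.
Export numFieldNormedType.Exports.

Local Open Scope classical_set_scope.
Local Open Scope ring_scope.
Local Open Scope complex_scope.

Definition cexp (R : realType) (z : R[i]) : R[i] :=
  (expR (complex.Re z) * cos (complex.Im z)) +i* (expR (complex.Re z) * sin (complex.Im z)).

Definition sinh (R : realType) (x : R) : R := (expR x - expR (- x)) / 2.

Definition cintegral (R : realType) (D : set R) (f : R -> R[i]) : R[i] :=
  (\int[lebesgue_measure]_(u in D) complex.Re (f u)) +i*
  (\int[lebesgue_measure]_(u in D) complex.Im (f u)).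

(* At u = 0 the quotient of hyperbolic sines takes the value 0 / 0 = 0; a single
   point does not affect the integral. *)
Definition JS (R : realType) (P a : int) (t : R[i]) : R[i] :=
  t^-1 * cintegral `[0, +oo[
    (fun u : R => cexp (- (P%:~R * u ^+ 2)%:C / t)
                  * (sinh ((P - a)%:~R * u) / sinh (P%:~R * u))%:C).

(* [sqrtc] is the principal branch (nonnegative real part), unlike [sqrtC], whose
   values have nonnegative imaginary part. *)
Definition calL_coord (R : realType) (p j : int) (t : R[i]) : R[i] :=
  sqrtc ((48 * p)%:~R * t / pi%:C) *
    ((Num.sg (6 * j - p))%:~R * JS (12 * p) `|12 * j - 2 * p| t
     + JS (12 * p) (14 * p - 12 * j) t
     + JS (12 * p) (12 * j + 2 * p) t
     + JS (12 * p) (10 * p - 12 * j) t).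

Definition ell (p : nat) : nat := (p.-1 %/ 2)%N.

(* An ordinal i < ell p stands for the index i + 1 of 1, ..., ell p. *)
Definition calL (R : realType) (p : nat) (t : R[i]) : 'cV[R[i]]_(ell p) :=
  \col_(i < ell p) calL_coord (Posz p) (Posz i.+1) t.

Definition mixing_mx (R : realType) (p : nat) : 'M[R]_(ell p) :=
  \matrix_(i < ell p, k < ell p)
    (2 / Num.sqrt p%:R * (-1) ^+ (i.+1 + k.+1 + (p + 3) %/ 6)%N
     * sin (6 * i.+1%:R * k.+1%:R * pi / p%:R)).

(* Complex differentiability at every point of D, for D open: [derivable] in the
   direction 1 of R[i] as a one-dimensional normed space over itself. *)
Definition holomorphic_on (R : realType) (D : set R[i]) (f : R[i] -> R[i]) :=
  forall z, D z -> derivable (f : R[i]^o -> R[i]^o) z 1.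

(* Main.v *)
(* Combining the quotients of hyperbolic sines in pairs cancels a factor
   2 sinh(6pu), so that L_j(t) is, up to elementary factors, the Gaussian transform
   of a signed sum of two quotients cosh(a u) / cosh(6pu) with |a| < 6p.
   Such a quotient is the cosine transform of Re sech(2w + is), s = pi a / 12p. To
   see this, differentiate int_0^oo e^(ixw) sech(2w + is) dw in s: as sech is
   holomorphic, an integration by parts turns this into a first-order differential
   equation whose real part is solved by cosh(xs/2); the constant is found by letting
   s tend to pi/2, where Re sech(2w + is) concentrates at w = 0.
   By Parseval's formula against a Gaussian, L_j(t) is therefore also a Gaussian
   transform at the point belonging to pi^2/t, of the dual kernel
   Re sech(2w + i(pi/3 - th)) - Re sech(2w + i(pi/3 + th)) with th = pi j / p.
   Multiplying by cosh(12w) + cos(6 th) makes the combination of the original kernels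
   with coefficients in row j of the mixing matrix telescope, and identifies it with
   the dual kernel up to a constant. *)
Require Import Defs.
From mathcomp Require Import measurable_realfun zify ring lra.

Set Implicit Arguments.
Unset Strict Implicit.
Unset Printing Implicit Defensive.

Import Normc.

Local Open Scope classical_set_scope.
Local Open Scope ring_scope.
Local Open Scope complex_scope.

Section RealDerivatives.
Variable R : realType.
Implicit Types (f g : R -> R) (x a b : R).

Lemma is_derive1M f g x a b : is_derive x 1 f a -> is_derive x 1 g b ->
  is_derive x 1 (fun y => f y * g y) (f x * b + g x * a).
Proof. by move=> df dg; apply: is_deriveM. Qed.

Lemma is_derive1V f x a : f x != 0 -> is_derive x 1 f a ->
  is_derive x 1 (fun y => (f y)^-1) (- (f x ^- 2 * a)).
Proof.
by move=> fx0 df; apply: is_derive_eq (is_deriveV fx0 df) _; rewrite /GRing.scale /= mulNr.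
Qed.

Lemma is_derive1X f n x a : is_derive x 1 f a ->
  is_derive x 1 (fun y => f y ^+ n) (n%:R * f x ^+ n.-1 * a).
Proof.
move=> df; have -> : (fun y => f y ^+ n) = f ^+ n by rewrite exprfctE.
exact: is_derive_eq (is_deriveX n df) _.
Qed.

Lemma is_derive1_chain f g x a b : is_derive (g x) 1 f a -> is_derive x 1 g b ->
  is_derive x 1 (fun y => f (g y)) (a * b).
Proof. by move=> df dg; apply: (is_derive1_comp df dg). Qed.

Lemma is_derive1_continuous f x a : is_derive x 1 f a -> {for x, continuous f}.
Proof. by move=> df; apply/differentiable_continuous/derivable1_diffP; case: df. Qed.

End RealDerivatives.

(* The value of the derivative is left to unification; the derivatives of the
   elementary functions are found among the instances of [is_derive]. *)
Ltac is_derive1_step :=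
  first [eassumption |
  lazymatch goal with
  | |- is_derive _ _ (fun y => y) _ => apply: is_derive_id
  | |- is_derive _ _ (fun _ => ?c) _ => apply: is_derive_cst
  | |- is_derive _ _ (fun y => @?f y + @?g y) _ =>
      eapply (@is_deriveD _ _ _ f g); is_derive1_step
  | |- is_derive _ _ (fun y => - @?f y) _ =>
      eapply (@is_deriveN _ _ _ f); is_derive1_step
  | |- is_derive _ _ (fun y => @?f y * @?g y) _ =>
      eapply (@is_derive1M _ f g); is_derive1_step
  | |- is_derive _ _ (fun y => (@?f y)^-1) _ =>
      eapply (@is_derive1V _ f); [ | is_derive1_step]
  | |- is_derive _ _ (fun y => (@?f y) ^+ ?n) _ =>
      eapply (@is_derive1X _ f n); is_derive1_step
  | |- is_derive _ _ (fun y => ?h (@?f y)) _ =>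
      eapply (@is_derive1_chain _ h f); [exact _ | is_derive1_step]
  end].

Ltac is_derive1_calc := eapply is_derive_eq; [is_derive1_step | ].

Section Hyperbolic.
Variable R : realType.
Implicit Types x y : R.

Definition cosh x : R := (expR x + expR (- x)) / 2.

Global Instance is_derive_cosh x : is_derive x 1 cosh (sinh x).
Proof.
have -> : cosh = fun y => (expR y + expR (- y)) / 2 by [].
by is_derive1_calc; rewrite /sinh; field.
Qed.

Global Instance is_derive_sinh x : is_derive x 1 (@sinh R) (cosh x).
Proof.
have -> : @sinh R = fun y => (expR y - expR (- y)) / 2 by [].
by is_derive1_calc; rewrite /cosh; field.
Qed.

Lemma sinh0 : sinh (0 : R) = 0.
Proof. by rewrite /sinh oppr0 subrr mul0r. Qed.

Lemma coshN x : cosh (- x) = cosh x.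
Proof. by rewrite /cosh opprK addrC. Qed.

Lemma sinhN x : sinh (- x) = - sinh x.
Proof. by rewrite /sinh opprK; ring. Qed.

Lemma coshD x y : cosh (x + y) = cosh x * cosh y + sinh x * sinh y.
Proof. by rewrite /cosh /sinh opprD !expRD; field. Qed.

Lemma sinhD x y : sinh (x + y) = sinh x * cosh y + cosh x * sinh y.
Proof. by rewrite /cosh /sinh opprD !expRD; field. Qed.

Lemma cosh_gt0 x : 0 < cosh x.
Proof. by rewrite divr_gt0 // addr_gt0 ?expR_gt0. Qed.

Lemma cosh2Bsinh2 x : cosh x ^+ 2 - sinh x ^+ 2 = 1.
Proof.
transitivity (expR x * expR (- x)); first by rewrite /cosh /sinh; field.
by rewrite -expRD subrr expR0.
Qed.

Lemma cosh_ge1 x : 1 <= cosh x.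
Proof.
rewrite -ler_sqr ?nnegrE ?(ltW (cosh_gt0 x)) // expr1n -(cosh2Bsinh2 x).
by rewrite lerBlDr lerDl sqr_ge0.
Qed.

Lemma coshDB x y : cosh (x + y) + cosh (x - y) = 2 * (cosh x * cosh y).
Proof. by rewrite !coshD coshN sinhN; ring. Qed.

Lemma sinhDB x y : sinh (x + y) + sinh (x - y) = 2 * (sinh x * cosh y).
Proof. by rewrite !sinhD coshN sinhN; ring. Qed.

Lemma ler_sinh x y : x <= y -> sinh x <= sinh y.
Proof.
move=> xy; have exy : expR x <= expR y by rewrite ler_expR.
have eNxy : expR (- y) <= expR (- x) by rewrite ler_expR lerN2.
by rewrite /sinh; lra.
Qed.

Lemma sinh_ge0 x : 0 <= x -> 0 <= sinh x.
Proof. by move=> x0; rewrite -sinh0 ler_sinh. Qed.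

Lemma sinh_gt0 x : 0 < x -> 0 < sinh x.
Proof. by move=> x0; rewrite divr_gt0 // subr_gt0 ltr_expR; lra. Qed.

Lemma le_sinh2 x : 0 <= x -> x <= sinh (2 * x).
Proof.
move=> x0; have expR_ge := expR_ge1Dx (2 * x).
have expRN_le1 : expR (- (2 * x)) <= 1 by rewrite -[leRHS]expR0 ler_expR; lra.
by rewrite /sinh; lra.
Qed.

Lemma cosh_le_expR_normM x y : 0 <= y -> cosh (x * y) <= expR (`|x| * y).
Proof.
move=> y0; have expR_le z : `|z| = `|x| -> expR (z * y) <= expR (`|x| * y).
  by move=> zx; rewrite ler_expR ler_wpM2r // -zx ler_norm.
by have := expR_le _ erefl; have := expR_le _ (normrN x); rewrite /cosh mulNr; lra.
Qed.

Lemma invr_cosh_le x : (cosh x)^-1 <= 2 * expR (- x).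
Proof.
rewrite -[leRHS]invrK lef_pV2 ?posrE ?cosh_gt0 ?invr_gt0 ?mulr_gt0 ?expR_gt0//.
by rewrite invfM -expRN opprK mulrC ler_pM2r ?invr_gt0 // lerDl expR_ge0.
Qed.

Lemma cosh_mul2 x : cosh (2 * x) = 2 * cosh x ^+ 2 - 1.
Proof.
by rewrite (_ : 2 * x = x + x) ?coshD; [have := cosh2Bsinh2 x; lra | ring].
Qed.

Lemma cosh3 x : cosh (3 * x) = 4 * cosh x ^+ 3 - 3 * cosh x.
Proof.
rewrite (_ : 3 * x = x + (x + x)) ?coshD ?sinhD; last by ring.
transitivity (4 * cosh x ^+ 3 - 3 * cosh x * (cosh x ^+ 2 - sinh x ^+ 2)); first by ring.
by rewrite cosh2Bsinh2 mulr1.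
Qed.

Lemma cosh5 x : cosh (5 * x) = cosh x * (4 * cosh (2 * x) ^+ 2 - 2 * cosh (2 * x) - 1).
Proof.
have h3 := coshDB (2 * x) x; have h5 := coshDB (2 * x + x) (2 * x).
rewrite (_ : 5 * x = 2 * x + x + 2 * x); last by ring.
rewrite (_ : 2 * x - x = x) in h3; last by ring.
rewrite (_ : 2 * x + x - 2 * x = x) in h5; last by ring.
by move: h3 h5 => /(canRL (addrK _)) -> /(canRL (addrK _)) ->; ring.
Qed.

End Hyperbolic.

Section Trigonometry.
Variable R : realType.
Implicit Types x : R.

Lemma sinDnpi x n : sin (x + n%:R * pi) = (-1) ^+ n * sin x.
Proof. by rewrite mulr_natl (alternatingn (@sinDpi R)). Qed.

Lemma cosBpi x : cos (pi - x) = - cos x.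
Proof. by rewrite cosB cospi sinpi mul0r addr0 mulN1r. Qed.

Lemma cos_mul2 x : cos (2 * x) = 1 - 2 * sin x ^+ 2.
Proof. by rewrite mulr_natl cos_mulr2n cos2sin2; ring. Qed.

Lemma cos3 x : cos (3 * x) = 4 * cos x ^+ 3 - 3 * cos x.
Proof.
rewrite (_ : 3 * x = x + (x + x)) ?cosD ?sinD; last by ring.
transitivity (4 * cos x ^+ 3 - 3 * cos x * (cos x ^+ 2 + sin x ^+ 2)); first by ring.
by rewrite cos2Dsin2 mulr1.
Qed.

Lemma cos_pi3 : cos (pi / 3) = 1 / 2 :> R.
Proof.
have p0 := pi_gt0 R.
have c0 : 0 < cos (pi / 3 : R) by apply: cos_gt0_pihalf; apply/andP; split; lra.
have := cos3 (pi / 3 : R); rewrite (_ : 3 * (pi / 3) = pi) ?cospi; last by field.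
set c := cos _ in c0 * => e.
have : (c + 1) * (2 * c - 1) ^+ 2 = 0.
  by transitivity (4 * c ^+ 3 - 3 * c + 1); [ring | rewrite -e addNr].
by move/eqP; rewrite mulf_eq0 sqrf_eq0 => /orP[] /eqP; lra.
Qed.

Lemma sin_pi3 : sin (pi / 3) = Num.sqrt 3 / 2 :> R.
Proof.
have p0 := pi_gt0 R.
have s0 : 0 < sin (pi / 3 : R) by apply: sin_gt0_pi; apply/andP; split; lra.
apply/eqP; rewrite -(eqrXn2 (n := 2)) ?ltW // ?divr_ge0 ?sqrtr_ge0 //.
by rewrite expr_div_n sqr_sqrtr // sin2cos2 cos_pi3; apply/eqP; field.
Qed.

Lemma sin5 x : sin (5 * x) = sin x * (4 * cos (2 * x) ^+ 2 + 2 * cos (2 * x) - 1).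
Proof.
have e3 : sin (2 * x + x) = sin x * (2 * cos (2 * x) + 1).
  have : sin (2 * x + x) - sin (2 * x - x) = 2 * cos (2 * x) * sin x.
    by rewrite sinB sinD; ring.
  by rewrite (_ : 2 * x - x = x) => [/(canRL (subrK _)) ->|]; ring.
have : sin (2 * x + x + 2 * x) + sin (2 * x + x - 2 * x) = 2 * sin (2 * x + x) * cos (2 * x).
  by rewrite (sinB (2 * x + x)) (sinD (2 * x + x)); ring.
rewrite (_ : 2 * x + x - 2 * x = x) => [/(canRL (addrK _))|]; last by ring.
by rewrite (_ : 5 * x = 2 * x + x + 2 * x) => [->|]; rewrite ?e3; ring.
Qed.

End Trigonometry.

Section ComplexNumbers.
Variable R : realType.
Local Notation C := R[i].
Local Notation Re := (@complex.Re R).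
Local Notation Im := (@complex.Im R).
Implicit Types (z u : C) (x : R).

Lemma complex_eq z u : Re z = Re u -> Im z = Im u -> z = u.
Proof. by case: z u => [? ?] [? ?] /= -> ->. Qed.

Lemma ReD z u : Re (z + u) = Re z + Re u. Proof. by case: z u => [? ?] [? ?]. Qed.
Lemma ImD z u : Im (z + u) = Im z + Im u. Proof. by case: z u => [? ?] [? ?]. Qed.
Lemma ReN z : Re (- z) = - Re z. Proof. by case: z. Qed.
Lemma ImN z : Im (- z) = - Im z. Proof. by case: z. Qed.
Lemma ReM z u : Re (z * u) = Re z * Re u - Im z * Im u.
Proof. by case: z u => [? ?] [? ?]. Qed.
Lemma ImM z u : Im (z * u) = Re z * Im u + Im z * Re u.
Proof. by case: z u => [? ?] [? ?]. Qed.
Lemma ReMr z x : Re (z * x%:C) = Re z * x.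
Proof. by rewrite ReM mulr0 subr0. Qed.
Lemma ImMr z x : Im (z * x%:C) = Im z * x.
Proof. by rewrite ImM mulr0 add0r. Qed.
Lemma ReV z : Re z^-1 = Re z / (Re z ^+ 2 + Im z ^+ 2). Proof. by case: z. Qed.
Lemma ImV z : Im z^-1 = - (Im z / (Re z ^+ 2 + Im z ^+ 2)). Proof. by case: z. Qed.

Definition ReImE := (ReD, ImD, ReN, ImN, ReMr, ImMr, ReM, ImM).

Lemma normr_complexE z : `|z| = (normc z)%:C. Proof. by case: z. Qed.

Lemma normc_ge0 z : 0 <= normc z.
Proof. by case: z => a b; exact: sqrtr_ge0. Qed.

Lemma sqr_normcE z : normc z ^+ 2 = Re z ^+ 2 + Im z ^+ 2.
Proof. by case: z => a b; rewrite sqr_sqrtr // addr_ge0 ?sqr_ge0. Qed.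

Lemma normc_real x : normc x%:C = `|x|.
Proof. by rewrite /= expr0n addr0 sqrtr_sqr. Qed.

Lemma normc_nat n : normc (n%:R : C) = n%:R.
Proof. by rewrite -(rmorph_nat (real_complex R)) normc_real normr_nat. Qed.

Lemma normc_i : normc ('i%C : C) = 1.
Proof. by rewrite /= expr0n expr1n add0r sqrtr1. Qed.

Lemma normc_conjc z : normc z^* = normc z.
Proof. by case: z => a b /=; rewrite sqrrN. Qed.

Lemma Re_mulconjc z : Re (z^* * z) = normc z ^+ 2.
Proof. by rewrite sqr_normcE; case: z => a b /=; ring. Qed.

Lemma normr_Re_le z : `|Re z| <= normc z.
Proof. by rewrite -lecR -normr_complexE normc_ge_Re. Qed.

Lemma normr_Im_le z : `|Im z| <= normc z.
Proof. by case: z => a b; rewrite -sqrtr_sqr ler_wsqrtr // lerDr sqr_ge0. Qed.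

Lemma real_complex_neq0 x : (x%:C != 0 :> C) = (x != 0).
Proof. by rewrite -[0]/(0%:C) (inj_eq (@complexI R)). Qed.

Lemma Re_gt0_neq0 z : 0 < Re z -> z != 0.
Proof. by apply: contraTneq => ->; rewrite ltxx. Qed.

Lemma divc_Re_gt0 x z : 0 < x -> 0 < Re z -> 0 < Re (x%:C / z).
Proof.
move=> x0 z0; rewrite mulrC ReMr mulr_gt0 // ReV divr_gt0 //.
by rewrite ltr_pwDl ?exprn_gt0 ?sqr_ge0.
Qed.

End ComplexNumbers.

Section ComplexValuedDerivatives.
Variable R : realType.
Local Notation C := R[i].
Local Notation Re := (@complex.Re R).
Local Notation Im := (@complex.Im R).
Implicit Types (f g : R -> C) (x y : R) (a b c z : C).

Definition is_cderive f x a :=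
  is_derive x 1 (fun y => Re (f y)) (Re a) /\ is_derive x 1 (fun y => Im (f y)) (Im a).

Lemma is_cderive_eq f x a b : is_cderive f x a -> a = b -> is_cderive f x b.
Proof. by move=> + <-. Qed.

Lemma is_cderive_cst c x : is_cderive (fun=> c) x 0.
Proof. by split; exact: is_derive_cst. Qed.

Lemma is_cderive_real (f : R -> R) x (a : R) :
  is_derive x 1 f a -> is_cderive (fun y => (f y)%:C) x a%:C.
Proof. by split=> //; exact: is_derive_cst. Qed.

Lemma is_cderiveD f g x a b : is_cderive f x a -> is_cderive g x b ->
  is_cderive (fun y => f y + g y) x (a + b).
Proof.
by move=> [fR fI] [gR gI]; split; under eq_fun do rewrite ?ReImE;
  is_derive1_calc; rewrite ReImE.
Qed.

Lemma is_cderiveN f x a : is_cderive f x a -> is_cderive (fun y => - f y) x (- a).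
Proof.
by move=> [fR fI]; split; under eq_fun do rewrite ?ReImE; is_derive1_calc; rewrite ReImE.
Qed.

Lemma is_cderiveM f g x a b : is_cderive f x a -> is_cderive g x b ->
  is_cderive (fun y => f y * g y) x (f x * b + g x * a).
Proof.
by move=> [fR fI] [gR gI]; split; under eq_fun do rewrite ?ReImE;
  is_derive1_calc; rewrite !ReImE; ring.
Qed.

Lemma is_cderiveV f x a : f x != 0 -> is_cderive f x a ->
  is_cderive (fun y => (f y)^-1) x (- (f x ^- 2 * a)).
Proof.
move=> fx0 [fR fI].
have n0 : Re (f x) ^+ 2 + Im (f x) ^+ 2 != 0.
  by rewrite -sqr_normcE sqrf_eq0; apply: contra fx0 => /eqP/eq0_normc ->.
split; [under eq_fun do rewrite ReV | under eq_fun do rewrite ImV];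
  by is_derive1_calc => //; rewrite -(exprVn (f x)) expr2 !ReImE ReV ImV; field.
Qed.

Lemma is_cderive_rect (f g : R -> R) x (a b : R) : is_derive x 1 f a ->
  is_derive x 1 g b -> is_cderive (fun y => f y +i* g y) x (a +i* b).
Proof. by []. Qed.

Lemma is_cderive_cexp f x a : is_cderive f x a ->
  is_cderive (fun y => cexp (f y)) x (cexp (f x) * a).
Proof. by move=> [fR fI]; split; rewrite /cexp /=; is_derive1_calc; rewrite ReImE /=; ring. Qed.

Definition ccosh z : C :=
  (cosh (Re z) * cos (Im z)) +i* (sinh (Re z) * sin (Im z)).

Definition csinh z : C :=
  (sinh (Re z) * cos (Im z)) +i* (cosh (Re z) * sin (Im z)).

Lemma is_cderive_ccosh f x a : is_cderive f x a ->
  is_cderive (fun y => ccosh (f y)) x (csinh (f x) * a).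
Proof. by move=> [fR fI]; split; rewrite /ccosh /=; is_derive1_calc; rewrite ReImE /=; ring. Qed.

Lemma is_cderive_csinh f x a : is_cderive f x a ->
  is_cderive (fun y => csinh (f y)) x (ccosh (f x) * a).
Proof. by move=> [fR fI]; split; rewrite /csinh /=; is_derive1_calc; rewrite ReImE /=; ring. Qed.

(* Apply the real mean value theorem to the component of [f] along
   [f b - f a]. *)
Lemma normc_le_cderive f (f' : R -> C) (a b M : R) : a <= b ->
  (forall x, a <= x <= b -> is_cderive f x (f' x)) ->
  (forall x, a <= x <= b -> normc (f' x) <= M) ->
  normc (f b - f a) <= M * (b - a).
Proof.
move=> ab df f'M; set v := f b - f a.
pose g x := Re (v^* * f x).
have dg x : a <= x <= b -> is_derive x 1 g (Re (v^* * f' x)).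
  move=> /df dfx; have [dRe _] := is_cderiveM (is_cderive_cst v^* x) dfx.
  by apply: is_derive_eq dRe _; rewrite mulr0 addr0.
have [x||x] := @MVT_segment _ g (fun x => Re (v^* * f' x)) a b ab.
- by rewrite in_itv /= => /andP[/ltW ax /ltW xb]; apply: dg; rewrite ax.
- apply: derivable_within_continuous => x; rewrite in_itv /= => /dg.
  by case.
rewrite in_itv /= => xab gE.
have : normc v ^+ 2 <= normc v * (M * (b - a)).
  rewrite -Re_mulconjc /v mulrBr ReD ReN gE mulrA ler_wpM2r ?subr_ge0 //.
  apply: le_trans (le_trans (ler_norm _) (normr_Re_le _)) _.
  by rewrite normcM normc_conjc ler_wpM2l ?normc_ge0 // f'M.
have [->|v0] := eqVneq (normc v) 0.
  rewrite mulr_ge0 ?subr_ge0 // (le_trans (normc_ge0 (f' a))) // f'M // lexx.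
  exact: ab.
by rewrite expr2 ler_pM2l // lt_neqAle eq_sym v0 normc_ge0.
Qed.

Lemma is_cderive0_eq f (a b : R) : a <= b ->
  (forall x, a <= x <= b -> is_cderive f x 0) -> f a = f b.
Proof.
move=> ab df; apply/esym/eqP; rewrite -subr_eq0; apply/eqP/eq0_normc/le_anti.
rewrite normc_ge0 andbT -(mul0r (b - a)).
by apply: normc_le_cderive ab df _ => x _; rewrite normc0.
Qed.

End ComplexValuedDerivatives.

Ltac is_cderive_step :=
  first [eassumption |
  lazymatch goal with
  | |- is_cderive (fun _ => ?c) _ _ => apply: is_cderive_cst
  | |- is_cderive (fun y => @?f y + @?g y) _ _ =>
      eapply (@is_cderiveD _ f g); is_cderive_step
  | |- is_cderive (fun y => - @?f y) _ _ => eapply (@is_cderiveN _ f); is_cderive_step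
  | |- is_cderive (fun y => @?f y * @?g y) _ _ =>
      eapply (@is_cderiveM _ f g); is_cderive_step
  | |- is_cderive (fun y => (@?f y)^-1) _ _ =>
      eapply (@is_cderiveV _ f); [ | is_cderive_step]
  | |- is_cderive (fun y => (@?f y)%:C) _ _ =>
      eapply (@is_cderive_real _ f); is_derive1_step
  | |- is_cderive (fun y => (@?f y) +i* (@?g y)) _ _ =>
      eapply (@is_cderive_rect _ f g); is_derive1_step
  | |- is_cderive (fun y => cexp (@?f y)) _ _ =>
      eapply (@is_cderive_cexp _ f); is_cderive_step
  | |- is_cderive (fun y => ccosh (@?f y)) _ _ =>
      eapply (@is_cderive_ccosh _ f); is_cderive_step
  | |- is_cderive (fun y => csinh (@?f y)) _ _ =>
      eapply (@is_cderive_csinh _ f); is_cderive_step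
  end].

Ltac is_cderive_calc := eapply is_cderive_eq; [is_cderive_step | ].

Section ComplexExponential.
Variable R : realType.
Local Notation C := R[i].
Local Notation Re := (@complex.Re R).
Local Notation Im := (@complex.Im R).
Implicit Types (z u : C) (x k : R).

Lemma cexpD z u : cexp (z + u) = cexp z * cexp u.
Proof. by apply: complex_eq; rewrite !ReImE /= !ReImE expRD ?cosD ?sinD; ring. Qed.

Lemma cexp0 : cexp (0 : C) = 1.
Proof. by apply: complex_eq; rewrite /= expR0 ?cos0 ?sin0 mul1r. Qed.

Lemma cexp_real x : cexp x%:C = (expR x)%:C.
Proof. by rewrite /cexp /= cos0 sin0 mulr1 mulr0. Qed.

Lemma cexpNK z : cexp (- z) * cexp z = 1.
Proof. by rewrite -cexpD addNr cexp0. Qed.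

Lemma normc_cexp z : normc (cexp z) = expR (Re z).
Proof.
by rewrite /= !exprMn -mulrDr cos2Dsin2 mulr1 sqrtr_sqr ger0_norm ?expR_ge0.
Qed.

Lemma normc_cexp_im x : normc (cexp (0 +i* x) : C) = 1.
Proof. by rewrite normc_cexp expR0. Qed.

Lemma normc_cexp_scale z x : 0 <= x <= 1 -> normc (cexp (x%:C * z)) <= expR `|Re z|.
Proof.
move=> /andP[x0 x1]; rewrite normc_cexp ler_expR mulrC ReMr.
by rewrite (le_trans (ler_norm _)) // normrM (ger0_norm x0) ler_piMr.
Qed.

Lemma normc_cexpB1_le z : normc (cexp z - 1) <= normc z * expR `|Re z|.
Proof.
have := @normc_le_cderive R (fun x => cexp (x%:C * z)) (fun x => z * cexp (x%:C * z)) 0 1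
  (normc z * expR `|Re z|) ler01.
rewrite subr0 mulr1 mul1r mul0r cexp0; apply=> x x01; first by is_cderive_calc; ring.
by rewrite normcM ler_wpM2l ?normc_ge0 ?normc_cexp_scale.
Qed.

Lemma normc_cexpB1x_le z : normc (cexp z - 1 - z) <= normc z ^+ 2 * expR `|Re z|.
Proof.
have := @normc_le_cderive R (fun x => cexp (x%:C * z) - 1 - x%:C * z)
  (fun x => z * (cexp (x%:C * z) - 1)) 0 1 (normc z ^+ 2 * expR `|Re z|) ler01.
rewrite subr0 mulr1 mul1r mul0r cexp0 subrr !subr0; apply=> x x01.
  by is_cderive_calc; ring.
have /andP[x0 x1] := x01.
rewrite normcM expr2 -mulrA ler_wpM2l ?normc_ge0 //.
apply: le_trans (normc_cexpB1_le _) _.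
rewrite normcM normc_real (mulrC x%:C) ReMr normrM (ger0_norm x0).
rewrite ler_pM ?mulr_ge0 ?normc_ge0 ?expR_ge0 //; first by rewrite ler_piMl ?normc_ge0.
by rewrite ler_expR ler_piMr.
Qed.

Lemma onem_cos_le x : 1 - cos x <= x ^+ 2.
Proof.
have h := le_trans (normr_Re_le _) (normc_cexpB1x_le (0 +i* x)).
have : `|cos x - 1| <= x ^+ 2.
  move: h; rewrite !ReImE /= expR0 mul1r subr0 normr0 expR0 mulr1 expr0n add0r.
  by rewrite sqrtr_sqr real_normK ?num_real.
by rewrite distrC; apply: le_trans; exact: ler_norm.
Qed.

Lemma sqr_normc_ccosh z : normc (ccosh z) ^+ 2 = sinh (Re z) ^+ 2 + cos (Im z) ^+ 2.
Proof.
rewrite sqr_normcE /=; have := cosh2Bsinh2 (Re z); move: (cosh _) (sinh _) => c s.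
by move=> /(canRL (subrK _)) cE; rewrite !exprMn cE sin2cos2; ring.
Qed.

Lemma normc_csinh_le z : normc (csinh z) <= cosh (Re z).
Proof.
rewrite -ler_sqr ?nnegrE ?normc_ge0 ?(ltW (cosh_gt0 _)) //.
suff -> : normc (csinh z) ^+ 2 = cosh (Re z) ^+ 2 - cos (Im z) ^+ 2.
  by rewrite lerBlDr lerDl sqr_ge0.
rewrite sqr_normcE /=; have := cosh2Bsinh2 (Re z); move: (cosh _) (sinh _) => c s.
by move=> /(canRL (subrK _)) cE; rewrite !exprMn cE sin2cos2; ring.
Qed.

Lemma normc_ccosh_ge z k : 0 < k <= cos (Im z) -> k * cosh (Re z) <= normc (ccosh z).
Proof.
move=> /andP[k0 kc].
rewrite -ler_sqr ?nnegrE ?mulr_ge0 ?normc_ge0 ?(ltW (cosh_gt0 _)) ?(ltW k0) //.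
have k2 : k ^+ 2 <= cos (Im z) ^+ 2 by rewrite ler_sqr ?nnegrE; lra.
have c1 : cos (Im z) ^+ 2 <= 1 by rewrite cos2sin2 lerBlDr lerDl sqr_ge0.
rewrite sqr_normc_ccosh; have := cosh2Bsinh2 (Re z).
move: (cosh _) (sinh _) => c s /(canRL (subrK _)) cE; rewrite exprMn cE.
by have := sqr_ge0 s; nra.
Qed.

Lemma ccosh_neq0 z : 0 < cos (Im z) -> ccosh z != 0.
Proof.
move=> c0; apply/eqP => h.
have := @normc_ccosh_ge z (cos (Im z)); rewrite c0 lexx h normc0 => /(_ isT).
by rewrite leNgt mulr_gt0 ?cosh_gt0.
Qed.

End ComplexExponential.

Section ComplexDifferentiability.

Lemma is_derive1P (K : numFieldType) (f : K -> K) (z d : K) :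
  is_derive z 1 (f : K^o -> K^o) d <->
  forall e, 0 < e -> \forall h \near (0 : K), `|f (z + h) - f z - h * d| <= e * `|h|.
Proof.
pose q h : K^o := h^-1 *: ((f \o shift z) (h *: (1 : K^o)) - f z).
have dist_q h e : h != 0 ->
    (`|d - q h| <= e) = (`|f (z + h) - f z - h * d| <= e * `|h|).
  move=> h0; rewrite (_ : d - q h = - ((f (z + h) - f z - h * d) / h)); last first.
    by rewrite /q /GRing.scale /= mulr1 (addrC h); field.
  by rewrite normrN normrM normfV ler_pdivrMr ?normr_gt0.
split=> [[df dfE] e e0|rem].
  have : q h @[h --> (0 : K)^'] --> (d : K^o) by rewrite -dfE; exact: df.
  move/cvgrPdist_le => /(_ _ e0) near_q.
  have : \forall h \near (0 : K), h != 0 -> `|d - q h| <= e by exact: near_q.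
  apply: filterS => h hq; have [->|h0] := eqVneq h 0; last by rewrite -dist_q // hq.
  by rewrite addr0 subrr mul0r subr0 normr0 mulr0.
suff cvg_q : q h @[h --> (0 : K)^'] --> (d : K^o).
  by apply: DeriveDef; [apply/cvg_ex; exists d | exact/cvg_lim].
apply/cvgrPdist_le => /= e e0; near=> h.
have h0 : h != 0 by near: h; exact: nbhs_dnbhs_neq.
by rewrite dist_q //; near: h; apply: nbhs_dnbhs; exact: rem.
Unshelve. all: by end_near. Qed.

Lemma is_derive1_quadratic (K : numFieldType) (f : K -> K) (z d M r : K) :
  0 < r -> 0 <= M ->
  (forall h, `|h| < r -> `|f (z + h) - f z - h * d| <= M * `|h| ^+ 2) ->
  is_derive z 1 (f : K^o -> K^o) d.
Proof.
move=> r0 M0 fM; apply/is_derive1P => e e0; near=> h.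
have hr : `|h| < r by near: h; exact: (@nbhs0_lt _ K^o).
have he : `|h| <= e / (M + 1) by near: h; apply: (@nbhs0_le _ K^o); rewrite divr_gt0 // ltr_wpDl.
apply: le_trans (fM _ hr) _; rewrite expr2 mulrA ler_wpM2r //.
rewrite -[leRHS](@divfK _ (M + 1)) ?gt_eqF ?ltr_wpDl // mulrC.
by rewrite ler_pM // lerDl.
Unshelve. all: by end_near. Qed.

Variable R : realType.
Local Notation C := R[i].
Local Notation Re := (@complex.Re R).
Implicit Types (z v a d : C) (f g : C -> C).

Lemma is_derive1_line f a v d (r : R) :
  is_derive (a + r%:C * v : C^o) 1 (f : C^o -> C^o) d ->
  is_cderive (fun s : R => f (a + s%:C * v)) r (d * v).
Proof.
set u := a + _ => /is_derive1P df.
suff component (P : C -> R) : (forall u1 u2, P (u1 - u2) = P u1 - P u2) ->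
    (forall (x : R) w, P (x%:C * w) = x * P w) -> (forall w, `|P w| <= normc w) ->
    is_derive r 1 (fun s => P (f (a + s%:C * v))) (P (d * v)).
  split; apply: component => [u1 u2|x w|w].
  - by rewrite ReD ReN.
  - by rewrite mulrC ReMr mulrC.
  - exact: normr_Re_le.
  - by rewrite ImD ImN.
  - by rewrite mulrC ImMr mulrC.
  - exact: normr_Im_le.
move=> PB PZ Pn; apply/is_derive1P => e e0.
have n1 : 0 < normc v + 1 by rewrite ltr_wpDl ?normc_ge0.
have : 0 < (e / (normc v + 1))%:C :> C by rewrite -[0]/(0%:C) ltcR divr_gt0.
move=> /df /(@nbhs_norm0P _ C^o) [rho /= rho0 near_u].
have rhoE : rho = (Re rho)%:C by rewrite (RRe_real (gtr0_real rho0)).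
move: rho0; rewrite rhoE -[0]/(0%:C) ltcR => rho0.
near=> h.
have /near_u : `|h%:C * v| < rho.
  rewrite normr_complexE rhoE ltcR normcM normc_real.
  apply: (@le_lt_trans _ _ (`|h| * (normc v + 1))); first by rewrite ler_wpM2l // lerDl.
  by rewrite -ltr_pdivlMr //; near: h; apply: (@nbhs0_lt _ R^o); rewrite divr_gt0.
rewrite !normr_complexE -rmorphM lecR normcM normc_real => near_uh.
rewrite (_ : a + (r + h)%:C * v = u + h%:C * v) -/u; last by rewrite /u rmorphD /=; ring.
rewrite -PZ -!PB (mulrC d) mulrA; apply: le_trans (Pn _) (le_trans near_uh _).
rewrite mulrCA mulrC ler_wpM2r // mulrAC ler_pdivrMr // ler_wpM2l ?(ltW e0) //.
by rewrite lerDl.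
Unshelve. all: by end_near. Qed.

Lemma derivable1M f g z :
  derivable (f : C^o -> C^o) z 1 -> derivable (g : C^o -> C^o) z 1 ->
  derivable ((fun t => f t * g t) : C^o -> C^o) z 1.
Proof. exact: derivableM. Qed.

Lemma derivable1_comp f g z :
  derivable (f : C^o -> C^o) z 1 -> derivable (g : C^o -> C^o) (f z) 1 ->
  derivable ((fun t => g (f t)) : C^o -> C^o) z 1.
Proof.
move=> /derivable1_diffP df /derivable1_diffP dg.
by apply/derivable1_diffP; exact: (differentiable_comp df dg).
Qed.

End ComplexDifferentiability.

Section PrincipalSquareRoot.
Variable R : realType.
Local Notation C := R[i].
Local Notation Re := (@complex.Re R).
Implicit Types z u : C.

Lemma Re_sqrtc_ge0 z : 0 <= Re (sqrtc z).
Proof. by case: z => a b; exact: sqrtr_ge0. Qed.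

Lemma Re_sqrtc_gt0 z : 0 < Re z -> 0 < Re (sqrtc z).
Proof. by case: z => a b /= a0; rewrite sqrtr_gt0 divr_gt0 // ltr_wpDl // sqrtr_ge0. Qed.

Lemma sqrtc_unique z u : u ^+ 2 = z -> 0 < Re u -> sqrtc z = u.
Proof.
move=> uz u0; have : (sqrtc z - u) * (sqrtc z + u) = 0.
  by rewrite -subr_sqr sqr_sqrtc uz subrr.
move/eqP; rewrite mulf_eq0 => /orP[|]; first by rewrite subr_eq0 => /eqP.
rewrite addr_eq0 => /eqP e; have := Re_sqrtc_ge0 z.
by rewrite e ReN oppr_ge0 leNgt u0.
Qed.

Lemma sqrtc_mulr (x : R) z : 0 < x -> 0 < Re z ->
  sqrtc (x%:C * z) = (Num.sqrt x)%:C * sqrtc z.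
Proof.
move=> x0 z0; apply: sqrtc_unique.
  by rewrite exprMn sqr_sqrtc -rmorphXn sqr_sqrtr // ltW.
by rewrite mulrC ReMr mulr_gt0 ?sqrtr_gt0 ?Re_sqrtc_gt0.
Qed.

Lemma sqrtc_divr (x : R) z : 0 < x -> 0 < Re z ->
  sqrtc (x%:C / z) = (Num.sqrt x)%:C / sqrtc z.
Proof.
move=> x0 z0; apply: sqrtc_unique.
  by rewrite expr_div_n sqr_sqrtc -rmorphXn sqr_sqrtr // ltW.
by apply: divc_Re_gt0; rewrite ?sqrtr_gt0 ?Re_sqrtc_gt0.
Qed.

Lemma is_derive_sqrtc z : 0 < Re z ->
  is_derive (z : C^o) 1 (@sqrtc R : C^o -> C^o) (2 * sqrtc z)^-1.
Proof.
move=> z0; set s := sqrtc z; have m0 : 0 < Re s by exact: Re_sqrtc_gt0.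
have s0 := Re_gt0_neq0 m0.
have mC0 : 0 < (Re s)%:C :> C by rewrite -[0]/(0%:C) ltcR.
have norm_ge u : Re s <= Re u -> (Re s)%:C <= `|u|.
  move=> su; rewrite normr_complexE lecR.
  exact: le_trans su (le_trans (ler_norm _) (normr_Re_le u)).
apply: (@is_derive1_quadratic C _ z _ ((2 * (Re s)%:C) * (Re s)%:C ^+ 2)^-1 1 ltr01).
  by rewrite invr_ge0 mulr_ge0 ?exprn_ge0 ?mulr_ge0 ?(ltW mC0).
move=> h _; set s' := sqrtc (z + h).
have hE : h = s' ^+ 2 - s ^+ 2 by rewrite !sqr_sqrtc; ring.
have ss' : Re s <= Re (s' + s) by rewrite ReD lerDr Re_sqrtc_ge0.
have ss'0 : s' + s != 0 by apply: Re_gt0_neq0; exact: lt_le_trans ss'.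
have -> : s' - s - h * (2 * s)^-1 = - (h ^+ 2 * (2 * s * (s' + s) ^+ 2)^-1).
  by rewrite hE; field; rewrite ss'0 s0.
rewrite normrN normrM normfV normrX mulrC ler_wpM2r ?exprn_ge0 //.
have m20 : 0 <= (Re s)%:C ^+ 2 :> C by rewrite exprn_ge0 // ltW.
have m2 : 0 < 2 * (Re s)%:C :> C by rewrite mulr_gt0.
rewrite lef_pV2 ?posrE ?normr_gt0 ?mulf_neq0 ?expf_neq0 ?mulr_gt0 ?exprn_gt0 //.
rewrite 2!normrM normrX normr_nat ler_pM ?(ltW m2) ?ler_wpM2l ?norm_ge //.
by rewrite lerXn2r ?nnegrE ?normr_ge0 ?(ltW mC0) ?norm_ge.
Qed.

End PrincipalSquareRoot.

Section HalfLineIntegrals.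
Variable R : realType.
Local Notation mu := (@lebesgue_measure R).
Local Notation halfline := (`[(0 : R), +oo[%classic).
Implicit Types (f F : R -> R) (K L : R).

Let halflineP (w : R) : halfline w = (0 <= w) :> Prop.
Proof. by rewrite /= in_itv /= andbT. Qed.

Let exponential_pdf1 : exponential_pdf 1 = (fun w : R => expR (- w)) \_ halfline.
Proof. by congr (_ \_ _); apply/funext => w; rewrite mul1r mulN1r. Qed.

Lemma integrable_expN : mu.-integrable halfline (EFin \o (fun w => expR (- w))).
Proof.
apply/(integrable_mkcond _ _).2 => //; rewrite restrict_EFin -exponential_pdf1.
exact: integrable_exponential_pdf.
Qed.

Lemma Rintegral_expN : \int[mu]_(w in halfline) expR (- w) = 1.
Proof.
by rewrite Rintegral_mkcond -exponential_pdf1 /Rintegral integral_exponential_pdf.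
Qed.

Lemma integrableZ f K : mu.-integrable halfline (EFin \o f) ->
  mu.-integrable halfline (EFin \o (fun w => K * f w)).
Proof. by move=> fi; refine (integrableZl _ K fi). Qed.

Lemma is_derive1_measurable (D : set R) f :
  (forall w : R, exists d : R, is_derive w 1 f d) -> measurable_fun D f.
Proof.
move=> df; apply: measurable_funTS; apply: continuous_measurable_fun => w.
by have [d dfw] := df w; exact: is_derive1_continuous dfw.
Qed.

Lemma integrable_le_expN f K : measurable_fun halfline f ->
  (forall w, 0 <= w -> `|f w| <= K * expR (- w)) ->
  mu.-integrable halfline (EFin \o f).
Proof.
move=> mf fK; apply: (le_integrable _ _ _ (integrableZ K integrable_expN)) => //.
  exact/measurable_EFinP.
by move=> w; rewrite halflineP => w0; rewrite lee_fin (le_trans (fK _ w0)) ?ler_norm.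
Qed.

Lemma cvgy_le_expN F K : (forall w, 0 <= w -> `|F w| <= K * expR (- w)) ->
  F w @[w --> +oo] --> (0 : R).
Proof.
move=> FK; apply: norm_cvg0.
apply: (@squeeze_cvgr _ _ _ _ (cst 0) (fun w => K * expR (- w))).
- near=> w; rewrite normr_ge0 /=; apply: FK; near: w; exact: nbhs_pinfty_ge.
- exact: cvg_cst.
- by rewrite -(mulr0 K); apply: cvgM; [exact: cvg_cst | exact: cvgr_expR].
Unshelve. all: by end_near. Qed.

(* Adding [L * expR (- w)] to [f] makes the integrand nonnegative, which is the
   case covered by the library form of the fundamental theorem on half-lines. *)
Lemma Rintegral_derivative F f K L : (forall w : R, is_derive w 1 F (f w)) ->
  continuous f ->
  (forall w, 0 <= w -> `|F w| <= K * expR (- w)) ->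
  (forall w, 0 <= w -> `|f w| <= L * expR (- w)) ->
  \int[mu]_(w in halfline) f w = - F 0.
Proof.
move=> dF cf FK fL.
have fi : mu.-integrable halfline (EFin \o f).
  by apply: integrable_le_expN fL; exact: measurable_funTS (continuous_measurable_fun cf).
have ei := integrableZ L integrable_expN.
suff : \int[mu]_(w in halfline) (f w + L * expR (- w)) = L - F 0.
  rewrite RintegralD // RintegralZl ?Rintegral_expN ?mulr1 //; last exact: integrable_expN.
  by move=> h; apply: (addIr L); rewrite h addrC.
pose G w := F w - L * expR (- w).
have dG (w : R) : is_derive w 1 G (f w + L * expR (- w)).
  by rewrite /G; is_derive1_calc; ring.
rewrite (@Rintegral_ge0_continuous_FTC2y _ _ G 0 0).
- by rewrite /G oppr0 expR0; ring.
- by move=> w w0; have := fL _ w0; rewrite ler_norml => /andP[]; lra.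
- apply: continuous_subspaceT => w; apply: cvgD; first exact: cf.
  apply: cvgM; first exact: cvg_cst.
  exact: is_derive1_continuous (is_derive1_chain (is_derive_expR _) (is_deriveNid _ _)).
- rewrite [X in _ --> X](_ : 0 = 0 - L * 0); last by ring.
  apply: cvgB; first exact: cvgy_le_expN FK.
  by apply: cvgM; [exact: cvg_cst | exact: cvgr_expR].
- by move=> w _; case: (dG w).
- by apply: cvg_at_right_filter; exact: is_derive1_continuous (dG 0).
- by move=> w _; rewrite derive1E; case: (dG w).
Qed.

Lemma is_derive_Rintegral (f f' : R -> R -> R) (a u v K L : R) : u < a < v ->
  (forall x, u < x < v -> measurable_fun halfline (f x)) ->
  (forall (x w : R), u < x < v -> 0 <= w -> `|f x w| <= K * expR (- w)) ->
  (forall x w : R, u < x < v -> is_derive x 1 (f^~ w) (f' x w)) ->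
  (forall (x w : R), u < x < v -> 0 <= w -> `|f' x w| <= L * expR (- w)) ->
  is_derive a 1 (fun x => \int[mu]_(w in halfline) f x w)
    (\int[mu]_(w in halfline) f' a w).
Proof.
move=> auv mf fK df f'L.
have uvP x : `]u, v[%classic x = (u < x < v) :> Prop by rewrite /= in_itv.
have a_uv : `]u, v[%classic a by rewrite uvP.
have fi x : `]u, v[%classic x -> mu.-integrable halfline (EFin \o f x).
  by rewrite uvP => xuv; apply: integrable_le_expN (mf x xuv) _ => w; exact: fK.
have derivable_f x w : `]u, v[%classic x -> halfline w -> derivable (f^~ w) x 1.
  by rewrite uvP => xuv _; case: (df x w xuv).
have partial_f x w : u < x < v -> partial1of2 f x w = f' x w.
  by move=> xuv; rewrite partial1of2E; case: (df x w xuv).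
have L0 : 0 <= L.
  by have := le_trans (normr_ge0 _) (f'L _ 0 auv (lexx _)); rewrite oppr0 expR0 mulr1.
have Lexp_ge0 w : 0 <= L * expR (- w) by rewrite mulr_ge0 ?expR_ge0.
have partial_le x w : `]u, v[%classic x -> halfline w ->
    `|partial1of2 f x w| <= L * expR (- w).
  by rewrite uvP halflineP => xuv w0; rewrite partial_f ?f'L.
have mH : measurable halfline by [].
have Li := integrableZ L integrable_expN.
split.
  exact (@derivable_under_integral R _ _ mu f halfline mH a u v a_uv fi derivable_f
    _ Lexp_ge0 Li partial_le).
rewrite -derive1E.
rewrite (@differentiation_under_integral R _ _ mu f halfline mH a u v a_uv fi derivable_f
  _ Lexp_ge0 Li partial_le).
by apply: eq_Rintegral => w _; rewrite partial_f.
Qed.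

End HalfLineIntegrals.

Section ComplexHalfLineIntegrals.
Variable R : realType.
Local Notation mu := (@lebesgue_measure R).
Local Notation halfline := (`[(0 : R), +oo[%classic).
Local Notation C := R[i].
Local Notation Re := (@complex.Re R).
Local Notation Im := (@complex.Im R).
Implicit Types (f g F : R -> C) (c : C) (K L : R).

Definition cmeasurable f := measurable_fun halfline (fun w => Re (f w)) /\
  measurable_fun halfline (fun w => Im (f w)).

Definition ccontinuous f :=
  continuous (fun w => Re (f w)) /\ continuous (fun w => Im (f w)).

Definition cintegrable f := mu.-integrable halfline (EFin \o (fun w => Re (f w))) /\
  mu.-integrable halfline (EFin \o (fun w => Im (f w))).

Definition exp_decay f K := forall w, 0 <= w -> normc (f w) <= K * expR (- w).

Lemma is_cderive_ccontinuous f :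
  (forall x, exists a, is_cderive f x a) -> ccontinuous f.
Proof.
by move=> df; split=> x; have [a [dRe dIm]] := df x; exact: is_derive1_continuous.
Qed.

Lemma ccontinuous_cmeasurable f : ccontinuous f -> cmeasurable f.
Proof. by case=> cRe cIm; split; apply: measurable_funTS; exact: continuous_measurable_fun. Qed.

Lemma ccontinuous_real (f : R -> R) : continuous f -> ccontinuous (fun w => (f w)%:C).
Proof. by move=> cf; split=> // w; exact: cvg_cst. Qed.

Lemma ccontinuousD f g : ccontinuous f -> ccontinuous g ->
  ccontinuous (fun w => f w + g w).
Proof.
move=> [fR fI] [gR gI]; split=> w.
  by rewrite (funext (fun w => ReD (f w) (g w))); apply: cvgD; [exact: fR | exact: gR].
by rewrite (funext (fun w => ImD (f w) (g w))); apply: cvgD; [exact: fI | exact: gI].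
Qed.

Lemma ccontinuousM f g : ccontinuous f -> ccontinuous g ->
  ccontinuous (fun w => f w * g w).
Proof.
move=> [fR fI] [gR gI]; split=> w.
  rewrite (funext (fun w => ReM (f w) (g w))).
  by apply: cvgB; apply: cvgM; [exact: fR | exact: gR | exact: fI | exact: gI].
rewrite (funext (fun w => ImM (f w) (g w))).
by apply: cvgD; apply: cvgM; [exact: fR | exact: gI | exact: fI | exact: gR].
Qed.

Lemma cmeasurable_real (f : R -> R) :
  measurable_fun halfline f -> cmeasurable (fun w => (f w)%:C).
Proof. by move=> mf; split=> //; exact: measurable_cst. Qed.

Lemma cmeasurableM f g : cmeasurable f -> cmeasurable g ->
  cmeasurable (fun w => f w * g w).
Proof.
move=> [fR fI] [gR gI]; split.
  rewrite (funext (fun w => ReM (f w) (g w))).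
  by apply: measurable_funB; exact: measurable_funM.
rewrite (funext (fun w => ImM (f w) (g w))).
by apply: measurable_funD; exact: measurable_funM.
Qed.

Lemma normr_Re_decay f K w : exp_decay f K -> 0 <= w -> `|Re (f w)| <= K * expR (- w).
Proof. by move=> fK w0; exact: le_trans (normr_Re_le _) (fK _ w0). Qed.

Lemma normr_Im_decay f K w : exp_decay f K -> 0 <= w -> `|Im (f w)| <= K * expR (- w).
Proof. by move=> fK w0; exact: le_trans (normr_Im_le _) (fK _ w0). Qed.

Lemma exp_decay_cintegrable f K : cmeasurable f -> exp_decay f K -> cintegrable f.
Proof.
by move=> [mR mI] fK; split; apply: (@integrable_le_expN _ _ K) => // w w0;
  [exact: normr_Re_decay | exact: normr_Im_decay].
Qed.

Lemma eq_cintegral (D : set R) f g : (forall w, f w = g w) ->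
  cintegral D f = cintegral D g.
Proof. by move=> /funext ->. Qed.

Lemma eq_cintegral_gt0 f g : cintegrable f -> cintegrable g ->
  (forall w, 0 < w -> f w = g w) -> cintegral halfline f = cintegral halfline g.
Proof.
move=> [fR fI] [gR gI] fg.
have open_halfline (h : R -> R) : mu.-integrable halfline (EFin \o h) ->
    \int[mu]_(w in halfline) h w = \int[mu]_(w in `]0, +oo[) h w.
  move=> hi; rewrite -Rintegral_itv_obnd_cbnd //; apply: integrableS hi => //.
  by move=> w /=; rewrite !in_itv /= !andbT; exact: ltW.
rewrite /cintegral !open_halfline //.
by congr (_ +i* _); apply: eq_Rintegral => w; rewrite inE /= in_itv /= andbT => /fg ->.
Qed.

Lemma cintegrableD f g : cintegrable f -> cintegrable g ->
  cintegrable (fun w => f w + g w).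
Proof.
move=> [fR fI] [gR gI]; split.
  by rewrite (funext (fun w => ReD (f w) (g w))); refine (integrableD _ fR gR).
by rewrite (funext (fun w => ImD (f w) (g w))); refine (integrableD _ fI gI).
Qed.

Lemma cintegralD f g : cintegrable f -> cintegrable g ->
  cintegral halfline (fun w => f w + g w) = cintegral halfline f + cintegral halfline g.
Proof.
move=> [fR fI] [gR gI]; apply: complex_eq; rewrite ReImE /=;
  by under eq_Rintegral do rewrite ReImE; rewrite RintegralD.
Qed.

Lemma cintegrableZ c f : cintegrable f -> cintegrable (fun w => c * f w).
Proof.
move=> [fR fI]; split.
  rewrite (funext (fun w => ReM c (f w))).
  by refine (integrableB _ (integrableZ _ fR) (integrableZ _ fI)).
rewrite (funext (fun w => ImM c (f w))).
by refine (integrableD _ (integrableZ _ fI) (integrableZ _ fR)).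
Qed.

Lemma cintegralZ c f : cintegrable f ->
  cintegral halfline (fun w => c * f w) = c * cintegral halfline f.
Proof.
move=> [fR fI]; apply: complex_eq; rewrite !ReImE /=;
  under eq_Rintegral do rewrite ReImE.
  by rewrite RintegralB ?RintegralZl //; exact: integrableZ.
by rewrite RintegralD ?RintegralZl //; exact: integrableZ.
Qed.

(* Bound the component of the integral along its own direction. *)
Lemma normc_cintegral_le f K : cmeasurable f -> exp_decay f K ->
  normc (cintegral halfline f) <= K.
Proof.
move=> mf fK; have fi := exp_decay_cintegrable mf fK.
set c := cintegral _ _; have := cintegrableZ c^* fi => -[cfi _].
have : normc c ^+ 2 <= normc c * K.
  rewrite -Re_mulconjc -cintegralZ // -[leRHS]mulr1 -Rintegral_expN -RintegralZl //.
    apply: le_Rintegral => // [|w]; first exact: integrableZ (@integrable_expN R).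
    rewrite /= in_itv /= andbT => w0; apply: le_trans (ler_norm _) _.
    apply: le_trans (normr_Re_le _) _.
    by rewrite normcM normc_conjc -mulrA ler_wpM2l ?normc_ge0 ?fK.
  exact: integrable_expN.
have [->|c0] := eqVneq (normc c) 0.
  have := le_trans (normc_ge0 _) (fK _ (lexx 0)).
  by rewrite oppr0 expR0 mulr1.
by rewrite expr2 ler_pM2l // lt_neqAle eq_sym c0 normc_ge0.
Qed.

Lemma normr_Rintegral_le (f : R -> R) K : measurable_fun halfline f ->
  (forall w, 0 <= w -> `|f w| <= K * expR (- w)) ->
  `|\int[mu]_(w in halfline) f w| <= K.
Proof.
move=> mf fK; apply: le_trans (normr_Re_le (cintegral halfline (fun w => (f w)%:C))) _.
apply: normc_cintegral_le => [|w w0]; first exact: cmeasurable_real.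
by rewrite normc_real fK.
Qed.

Lemma cintegral_derivative F f K L : (forall w, is_cderive F w (f w)) ->
  ccontinuous f -> exp_decay F K -> exp_decay f L -> cintegral halfline f = - F 0.
Proof.
move=> dF [cRe cIm] FK fL; apply: complex_eq; rewrite ReImE.
  apply: (Rintegral_derivative (K := K) (L := L) (fun w => proj1 (dF w))) => // w.
    exact: normr_Re_decay.
  exact: normr_Re_decay.
apply: (Rintegral_derivative (K := K) (L := L) (fun w => proj2 (dF w))) => // w.
  exact: normr_Im_decay.
exact: normr_Im_decay.
Qed.

Lemma is_cderive_cintegral (f f' : R -> R -> C) (a u v K L : R) : u < a < v ->
  (forall x, u < x < v -> cmeasurable (f x) /\ exp_decay (f x) K) ->
  (forall x w, u < x < v -> is_cderive (f^~ w) x (f' x w)) ->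
  (forall x, u < x < v -> exp_decay (f' x) L) ->
  is_cderive (fun x => cintegral halfline (f x)) a (cintegral halfline (f' a)).
Proof.
move=> auv fK df f'L; split.
  apply: (is_derive_Rintegral (f' := fun x w => Re (f' x w)) (K := K) (L := L) auv).
  - by move=> x /fK[[]].
  - by move=> x w /fK[_ fxK]; exact: normr_Re_decay.
  - by move=> x w xuv; exact: (df x w xuv).1.
  - by move=> x w /f'L f'xL; exact: normr_Re_decay.
apply: (is_derive_Rintegral (f' := fun x w => Im (f' x w)) (K := K) (L := L) auv).
- by move=> x /fK[[]].
- by move=> x w /fK[_ fxK]; exact: normr_Im_decay.
- by move=> x w xuv; exact: (df x w xuv).2.
- by move=> x w /f'L f'xL; exact: normr_Im_decay.
Qed.

End ComplexHalfLineIntegrals.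

Section SechFourier.
Variable R : realType.
Local Notation mu := (@lebesgue_measure R).
Local Notation halfline := (`[(0 : R), +oo[%classic).
Local Notation C := R[i].
Local Notation Re := (@complex.Re R).
Local Notation Im := (@complex.Im R).
Implicit Types (x t w k : R) (z : C).

Definition csech z : C := (ccosh z)^-1.

Definition csech' z : C := - (csinh z / (ccosh z * ccosh z)).

Lemma normc_csech_le k t w : 0 < k <= cos t -> 0 <= w ->
  normc (csech ((2 * w) +i* t)) <= 2 / k * expR (- w).
Proof.
move=> kt w0; have /andP[k0 _] := kt; set z := _ +i* _.
have kc0 : 0 < k * cosh (2 * w) by rewrite mulr_gt0 ?cosh_gt0.
have kc : k * cosh (2 * w) <= normc (ccosh z) by exact: (normc_ccosh_ge (z := z)).
apply: (@le_trans _ _ (k * cosh (2 * w))^-1).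
  by rewrite normcV lef_pV2 ?posrE // (lt_le_trans kc0).
rewrite invfM (mulrC 2 k^-1) -mulrA ler_wpM2l ?invr_ge0 ?(ltW k0) //.
apply: le_trans (invr_cosh_le _) _.
by rewrite ler_pM2l // ler_expR; lra.
Qed.

Lemma normc_csech'_le k t w : 0 < k <= cos t -> 0 <= w ->
  normc (csech' ((2 * w) +i* t)) <= 2 / k ^+ 2 * expR (- w).
Proof.
move=> kt w0; have /andP[k0 _] := kt; set z := _ +i* _.
have c0 := cosh_gt0 (2 * w).
have kc : k * cosh (2 * w) <= normc (ccosh z) by exact: (normc_ccosh_ge (z := z)).
have -> : normc (csech' z) = normc (csinh z) / normc (ccosh z) * normc (csech z).
  by rewrite normcN !normcM !normcV normcM invfM mulrA.
have -> : 2 / k ^+ 2 * expR (- w) = k^-1 * (2 / k * expR (- w)) by rewrite expr2 invfM; ring.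
apply: ler_pM (normc_csech_le kt w0); rewrite ?divr_ge0 ?normc_ge0 //.
have z0 : 0 < normc (ccosh z) by apply: lt_le_trans kc; rewrite mulr_gt0.
rewrite ler_pdivrMr // ler_pdivlMl //.
by apply: le_trans kc; rewrite ler_wpM2l ?(ltW k0) // normc_csinh_le.
Qed.

Definition sech_wave x t w : C := cexp (0 +i* (x * w)) * csech ((2 * w) +i* t).

Definition sech_wave_dt x t w : C :=
  cexp (0 +i* (x * w)) * (csech' ((2 * w) +i* t) * 'i%C).

Definition sech_wave_dw x t w : C :=
  cexp (0 +i* (x * w)) * (csech' ((2 * w) +i* t) * 2 + x%:C * 'i%C * csech ((2 * w) +i* t)).

Lemma is_cderive_sech_wave_t x t w : 0 < cos t ->
  is_cderive (fun t => sech_wave x t w) t (sech_wave_dt x t w).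
Proof.
move=> c0; have z0 : ccosh ((2 * w) +i* t) != 0 by exact: ccosh_neq0.
rewrite /sech_wave /csech; is_cderive_calc => //.
by rewrite /sech_wave_dt /csech'; field.
Qed.

Lemma is_cderive_sech_wave_w x t w : 0 < cos t ->
  is_cderive (sech_wave x t) w (sech_wave_dw x t w).
Proof.
move=> c0; have z0 : ccosh ((2 * w) +i* t) != 0 by exact: ccosh_neq0.
rewrite /sech_wave /csech; is_cderive_calc => //.
have -> : (2 * 1 + w * 0) +i* 0 = 2 :> C by rewrite mulr1 mulr0 addr0 complexr0 rmorph_nat.
have -> : 0 +i* (x * 1 + w * 0) = x%:C * 'i%C.
  by rewrite mulr1 mulr0 addr0; apply: complex_eq; rewrite !ReImE /=; ring.
by rewrite /sech_wave_dw /csech' /csech; field.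
Qed.

(* The partial derivatives are proportional up to a multiple of the function
   itself because [csech] is holomorphic. *)
Lemma sech_wave_dtE x t w :
  sech_wave_dt x t w = 'i%C / 2 * sech_wave_dw x t w + (x / 2)%:C * sech_wave x t w.
Proof.
have i2 : 'i%C * 'i%C + 1 = 0 :> C by rewrite -expr2 sqr_i addNr.
rewrite -[LHS]addr0 -(mulr0 ((x / 2)%:C * sech_wave x t w)) -i2.
by rewrite /sech_wave_dt /sech_wave_dw /sech_wave rmorphM fmorphV rmorph_nat /=; field.
Qed.

Lemma ccontinuous_sech_wave x t : 0 < cos t -> ccontinuous (sech_wave x t).
Proof.
by move=> c0; apply: is_cderive_ccontinuous => w; eexists; exact: is_cderive_sech_wave_w.
Qed.

Lemma ccontinuous_sech_wave_dw x t : 0 < cos t -> ccontinuous (sech_wave_dw x t).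
Proof.
move=> c0; apply: is_cderive_ccontinuous => w; eexists.
have z0 : ccosh ((2 * w) +i* t) != 0 by exact: ccosh_neq0.
by rewrite /sech_wave_dw /csech' /csech; is_cderive_step; rewrite ?mulf_neq0.
Qed.

Lemma sech_wave_decay x t k : 0 < k <= cos t -> exp_decay (sech_wave x t) (2 / k).
Proof. by move=> kt w w0; rewrite normcM normc_cexp_im mul1r normc_csech_le. Qed.

Lemma sech_wave_dt_decay x t k : 0 < k <= cos t ->
  exp_decay (sech_wave_dt x t) (2 / k ^+ 2).
Proof.
move=> kt w w0; rewrite !normcM normc_cexp_im mul1r.
by rewrite normc_i mulr1 normc_csech'_le.
Qed.

Lemma sech_wave_dw_decay x t k : 0 < k <= cos t ->
  exp_decay (sech_wave_dw x t) (2 * (2 / k ^+ 2) + `|x| * (2 / k)).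
Proof.
move=> kt w w0; rewrite normcM normc_cexp_im mul1r.
apply: le_trans (le_normcD _ _) _; rewrite [leRHS]mulrDl lerD // !normcM.
  by rewrite normc_nat mulrC -mulrA ler_wpM2l ?normc_csech'_le.
by rewrite normc_i normc_real mulr1 -[leRHS]mulrA ler_wpM2l ?normc_csech_le.
Qed.

Definition sech_wave_integral x t := cintegral halfline (sech_wave x t).

Lemma cos_gt0_normr t : `|t| < pi / 2 -> 0 < cos t.
Proof. by move=> ht; apply: cos_gt0_pihalf; rewrite -ltr_norml. Qed.

Lemma cos_lbound_nbhs t : `|t| < pi / 2 ->
  exists2 r : R, `|t| < r & exists2 k, 0 < k & forall y, - r < y < r -> k <= cos y.
Proof.
move=> ht; have t0 := normr_ge0 t.
set r : R := (`|t| + pi / 2) / 2.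
have tr : `|t| < r by rewrite /r; lra.
exists r => //; exists (cos r); first by apply: cos_gt0_normr; rewrite /r gtr0_norm; lra.
move=> y; rewrite -ltr_norml -(cos_norm y) => yr; rewrite leNgt ltr_cos ?in_itv /=.
- by rewrite -leNgt ltW.
- by apply/andP; split; rewrite /r; lra.
- by apply/andP; split=> //; rewrite /r in yr; lra.
Qed.

Lemma cintegral_sech_wave_dw x t : `|t| < pi / 2 ->
  cintegral halfline (sech_wave_dw x t) = - (cos t)^-1%:C.
Proof.
move=> ht; have c0 := cos_gt0_normr ht.
have kt : 0 < cos t <= cos t by rewrite c0 lexx.
rewrite (cintegral_derivative (fun w => is_cderive_sech_wave_w x w c0)
  (ccontinuous_sech_wave_dw x c0) (sech_wave_decay x kt) (sech_wave_dw_decay x kt)).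
congr (- _); rewrite /sech_wave !mulr0 complexr0 cexp0 mul1r /csech fmorphV.
by congr _^-1; rewrite /ccosh /= sinh0 mul0r /cosh oppr0 expR0 divff // mul1r.
Qed.

Lemma is_cderive_sech_wave_integral x t : `|t| < pi / 2 ->
  is_cderive (sech_wave_integral x) t
    ((x / 2)%:C * sech_wave_integral x t - 'i%C * (2 * cos t)^-1%:C).
Proof.
move=> ht; have c0 := cos_gt0_normr ht; have [r tr [k k0 kr]] := cos_lbound_nbhs ht.
have kcos y : - r < y < r -> 0 < k <= cos y by move=> /kr ->; rewrite k0.
have cos0 y : - r < y < r -> 0 < cos y by move=> /kr; exact: lt_le_trans.
have kt : 0 < cos t <= cos t by rewrite c0 lexx.
have wi := exp_decay_cintegrable (ccontinuous_cmeasurable (ccontinuous_sech_wave x c0))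
  (sech_wave_decay x kt).
have wdi := exp_decay_cintegrable (ccontinuous_cmeasurable (ccontinuous_sech_wave_dw x c0))
  (sech_wave_dw_decay x kt).
have -> : (x / 2)%:C * sech_wave_integral x t - 'i%C * (2 * cos t)^-1%:C =
    cintegral halfline (sech_wave_dt x t).
  rewrite (eq_cintegral _ (sech_wave_dtE x t)) cintegralD; [|exact: cintegrableZ..].
  rewrite !cintegralZ // cintegral_sech_wave_dw // /sech_wave_integral.
  have -> : (2 * cos t)^-1%:C = 2^-1 * (cos t)^-1%:C :> C.
    by rewrite invfM rmorphM fmorphV rmorph_nat.
  by ring.
apply: (is_cderive_cintegral (u := - r) (v := r)
  (K := 2 / k) (L := 2 / k ^+ 2)); first by rewrite -ltr_norml.
- move=> y yr; split; last exact: sech_wave_decay (kcos _ yr).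
  exact: ccontinuous_cmeasurable (ccontinuous_sech_wave x (cos0 _ yr)).
- by move=> y w /cos0; exact: is_cderive_sech_wave_t.
- by move=> y /kcos; exact: sech_wave_dt_decay.
Qed.

Lemma Re_sech_wave_integral x t : 0 <= t < pi / 2 ->
  Re (sech_wave_integral x t) = Re (sech_wave_integral x 0) * expR (x / 2 * t).
Proof.
move=> /andP[t0 t1].
pose h y := expR (- (x / 2 * y)) * Re (sech_wave_integral x y).
have dh y : 0 <= y <= t -> is_derive y 1 h 0.
  move=> /andP[y0 yt]; have hy : `|y| < pi / 2 by rewrite ger0_norm //; lra.
  have [dRe _] := is_cderive_sech_wave_integral x hy.
  rewrite /h; is_derive1_calc; rewrite !ReImE /=; ring.
have : (h 0)%:C = (h t)%:C :> C.
  by apply: (is_cderive0_eq (f := fun y => (h y)%:C) t0) => y /dh; exact: is_cderive_real.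
move=> /complexI; rewrite /h mulr0 oppr0 expR0 mul1r => ->.
by rewrite mulrAC -expRD addNr expR0 mul1r.
Qed.

Definition cos_transform (f : R -> R) x :=
  \int[mu]_(w in halfline) (cos (x * w) * f w).

Definition sech_re t w := Re (csech ((2 * w) +i* t)).

Lemma sech_reE t w :
  sech_re t w = cosh (2 * w) * cos t / (sinh (2 * w) ^+ 2 + cos t ^+ 2).
Proof. by rewrite /sech_re /csech ReV -sqr_normcE sqr_normc_ccosh. Qed.

Lemma cos_transform_sech_re_wave x t : `|t| < pi / 2 ->
  cos_transform (sech_re t) x =
  (Re (sech_wave_integral x t) + Re (sech_wave_integral (- x) t)) / 2.
Proof.
move=> ht; have c0 := cos_gt0_normr ht.
have kt : 0 < cos t <= cos t by rewrite c0 lexx.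
have wi y := (exp_decay_cintegrable (ccontinuous_cmeasurable (ccontinuous_sech_wave y c0))
  (sech_wave_decay y kt)).1.
rewrite -RintegralD // -RintegralZr //; last first.
  by refine (integrableD _ (wi x) (wi (- x))).
apply: eq_Rintegral => w _; rewrite /sech_re /sech_wave; move: (csech _) => s.
by rewrite !ReM /= mulNr cosN sinN expR0; field.
Qed.

Lemma cos_transform_sech_re_scale x t : `|t| < pi / 2 ->
  cos_transform (sech_re t) x = cos_transform (sech_re 0) x * cosh (x / 2 * t).
Proof.
wlog t0 : t / 0 <= t => [hw|ht].
  have [/hw//|/ltW t0] := leP 0 t; rewrite -normrN => /(hw (- t)).
  rewrite mulrN coshN oppr_ge0 => /(_ t0) <-; apply: eq_Rintegral => w _.
  by rewrite !sech_reE cosN.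
have t01 : 0 <= t < pi / 2 by rewrite t0 -(ger0_norm t0).
have wave0 y : Re (sech_wave_integral y 0) = cos_transform (sech_re 0) y.
  have Im_ccosh w : Im (ccosh ((2 * w) +i* 0)) = 0 by rewrite /= sin0 mulr0.
  apply: eq_Rintegral => w _; rewrite ReM /csech ImV Im_ccosh mul0r oppr0 mulr0 subr0.
  by rewrite /cexp /= expR0 mul1r.
have even : cos_transform (sech_re 0) (- x) = cos_transform (sech_re 0) x.
  by apply: eq_Rintegral => w _; rewrite mulNr cosN.
rewrite (cos_transform_sech_re_wave x ht).
rewrite (Re_sech_wave_integral x t01) (Re_sech_wave_integral (- x) t01).
rewrite wave0 (wave0 (- x)) even.
by rewrite /cosh !mulNr; field.
Qed.

Lemma sech_re_ge0 t w : 0 < cos t -> 0 <= sech_re t w.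
Proof.
move=> c0; rewrite sech_reE divr_ge0 ?addr_ge0 ?sqr_ge0 //.
by rewrite mulr_ge0 // ltW // cosh_gt0.
Qed.

Lemma measurable_sech_re t : 0 < cos t -> measurable_fun halfline (sech_re t).
Proof.
move=> c0; have [] := ccontinuous_cmeasurable (ccontinuous_sech_wave 0 c0).
have -> : sech_wave 0 t = (fun w => csech ((2 * w) +i* t)).
  by apply/funext => w; rewrite /sech_wave mul0r cexp0 mul1r.
by [].
Qed.

Lemma normr_sech_re_le t w : 0 < cos t -> 0 <= w ->
  `|sech_re t w| <= 2 / cos t * expR (- w).
Proof.
move=> c0 w0; apply: le_trans (normr_Re_le _) (normc_csech_le _ w0).
by rewrite c0 lexx.
Qed.

Lemma Rintegral_sech_re t : `|t| < pi / 2 ->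
  \int[mu]_(w in halfline) sech_re t w = pi / 4.
Proof.
move=> ht; have c0 := cos_gt0_normr ht.
pose F w := atan (sinh (2 * w) / cos t) / 2.
have den_gt0 w : 0 < sinh (2 * w) ^+ 2 + cos t ^+ 2.
  by rewrite ltr_wpDl ?sqr_ge0 // exprn_gt0.
have dF (w : R) : is_derive w 1 F (sech_re t w).
  rewrite /F; is_derive1_calc; rewrite sech_reE.
  by have := den_gt0 w => D0; field; rewrite !gt_eqF // addrC.
rewrite (@Rintegral_ge0_continuous_FTC2y _ _ F 0 (pi / 4)).
- by rewrite /F mulr0 sinh0 mul0r atan0 mul0r subr0.
- by move=> w _; exact: sech_re_ge0.
- apply: continuous_subspaceT => w; rewrite (funext (sech_reE t)).
  eapply is_derive1_continuous; is_derive1_step.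
  by rewrite gt_eqF.
- rewrite [X in _ --> X](_ : pi / 4 = pi / 2 / 2); last by field.
  apply: cvgM; last exact: cvg_cst.
  apply: (@cvg_comp _ _ _ (fun w : R => sinh (2 * w) / cos t) atan _ +oo); last exact: cvgy_atan.
  apply/cvgryPge => A; near=> w.
  have w0 : 0 <= w by near: w; exact: nbhs_pinfty_ge.
  have wA : A <= w by near: w; apply: nbhs_pinfty_ge; exact: num_real.
  apply: le_trans wA _; rewrite ler_pdivlMr //.
  by apply: le_trans (le_sinh2 w0); rewrite ler_piMr ?cos_le1.
- by move=> w _; case: (dF w).
- by apply: cvg_at_right_filter; exact: is_derive1_continuous (dF 0).
- by move=> w _; rewrite derive1E; case: (dF w).
Unshelve. all: by end_near. Qed.

Lemma integrable_cos_sech_re x t : 0 < cos t ->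
  mu.-integrable halfline (EFin \o (fun w => cos (x * w) * sech_re t w)).
Proof.
move=> c0; apply: (@integrable_le_expN _ _ (2 / cos t)) => [|w w0].
  apply: measurable_funM (measurable_sech_re c0).
  by apply: is_derive1_measurable => w; eexists; is_derive1_step.
by rewrite normrM -[leRHS]mul1r ler_pM ?cos_max ?normr_sech_re_le.
Qed.

Lemma onem_cos_sech_re_le x t w : 0 < cos t -> 0 <= w ->
  (1 - cos (x * w)) * sech_re t w <= (x ^+ 2 + 2) * 2 * cos t * expR (- w).
Proof.
move=> c0 w0; rewrite sech_reE.
set a := 1 - cos (x * w); set c := cosh (2 * w); set s := sinh (2 * w).
have a2 : a <= 2 by have := cos_geN1 (x * w); rewrite /a; lra.
have ax : a <= x ^+ 2 * w ^+ 2 by rewrite -exprMn onem_cos_le.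
have ws : w ^+ 2 <= s ^+ 2 by rewrite lerXn2r ?nnegrE ?le_sinh2 // sinh_ge0 // mulr_ge0.
have cp : 0 < c by exact: cosh_gt0.
have D0 : 0 < s ^+ 2 + cos t ^+ 2 by rewrite ltr_wpDl ?sqr_ge0 // exprn_gt0.
have ac : a * c ^+ 2 <= (x ^+ 2 + 2) * s ^+ 2.
  have xws : x ^+ 2 * w ^+ 2 <= x ^+ 2 * s ^+ 2 by rewrite ler_wpM2l // sqr_ge0.
  have as2 : a * s ^+ 2 <= 2 * s ^+ 2 by rewrite ler_wpM2r // sqr_ge0.
  have -> : c ^+ 2 = 1 + s ^+ 2 by have := cosh2Bsinh2 (2 * w); rewrite -/c -/s; lra.
  by lra.
apply: (@le_trans _ _ ((x ^+ 2 + 2) * cos t * c^-1)); last first.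
  have : c^-1 <= 2 * expR (- w).
    by apply: le_trans (invr_cosh_le _) _; rewrite ler_pM2l // ler_expR; lra.
  rewrite -!mulrA (mulrCA 2) => ce; rewrite !ler_wpM2l ?(ltW c0) //.
  by rewrite addr_ge0 ?sqr_ge0.
set D := s ^+ 2 + cos t ^+ 2 in D0 *.
have -> : a * (c * cos t / D) = cos t / (c * D) * (a * c ^+ 2) by field; rewrite !gt_eqF.
have -> : (x ^+ 2 + 2) * cos t / c = cos t / (c * D) * ((x ^+ 2 + 2) * D).
  by field; rewrite !gt_eqF.
rewrite ler_wpM2l ?divr_ge0 ?mulr_ge0 ?(ltW c0) ?(ltW cp) ?(ltW D0) //.
apply: le_trans ac _; rewrite ler_wpM2l ?addr_ge0 ?sqr_ge0 //.
by rewrite lerDl sqr_ge0.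
Qed.

(* As [t] tends to [pi / 2] the mass of [sech_re t] concentrates at 0. *)
Lemma cos_transform_sech_re_near x t : `|t| < pi / 2 ->
  `|cos_transform (sech_re t) x - pi / 4| <= (x ^+ 2 + 2) * 2 * cos t.
Proof.
move=> ht; have c0 := cos_gt0_normr ht.
have mcos : measurable_fun halfline (fun w : R => cos (x * w)).
  by apply: is_derive1_measurable => w; eexists; is_derive1_step.
have msech := measurable_sech_re c0.
have seci : mu.-integrable halfline (EFin \o sech_re t).
  by apply: integrable_le_expN msech _ => w; exact: normr_sech_re_le.
rewrite -(Rintegral_sech_re ht) -RintegralB //; last exact: integrable_cos_sech_re.
apply: normr_Rintegral_le => [|w w0].
  by apply: measurable_funB => //; exact: measurable_funM.
rewrite -{2}(mul1r (sech_re t w)) -mulrBl normrM distrC.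
rewrite (ger0_norm (sech_re_ge0 w c0)) [`|1 - _|]ger0_norm ?subr_ge0 ?cos_le1 //.
exact: onem_cos_sech_re_le.
Qed.

Lemma cos_transform_sech_re0 x :
  cos_transform (sech_re 0) x * cosh (x / 2 * (pi / 2)) = pi / 4.
Proof.
set A := cos_transform (sech_re 0) x; pose M := (x ^+ 2 + 2) * 2.
apply/eqP; rewrite -subr_eq0 -normr_le0 -[leRHS](mulr0 M) -(cos_pihalf R) -subr_ge0.
pose g t := M * cos t - `|A * cosh (x / 2 * t) - pi / 4|.
have cvg_g : g t @[t --> (pi / 2)^'-] --> g (pi / 2).
  apply: cvg_at_left_filter; apply: cvgB.
    by apply: cvgM; [exact: cvg_cst | exact: continuous_cos].
  apply: cvg_norm; apply: cvgB; last exact: cvg_cst.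
  have dcosh : is_derive (pi / 2 : R) 1 (fun t => A * cosh (x / 2 * t))
    (A * (sinh (x / 2 * (pi / 2)) * (x / 2))) by is_derive1_calc; ring.
  exact: is_derive1_continuous dcosh.
apply: (cvgr_to_ge cvg_g); near=> t.
have t0 : 0 < t by near: t; apply: nbhs_left_gt; rewrite divr_gt0 ?pi_gt0.
have t1 : t < pi / 2 by near: t; exact: nbhs_left_lt.
have ht : `|t| < pi / 2 by rewrite gtr0_norm.
rewrite /g subr_ge0 /A -(cos_transform_sech_re_scale x ht).
exact: cos_transform_sech_re_near.
Unshelve. all: by end_near. Qed.

Theorem cos_transform_sech_re x t : `|t| < pi / 2 ->
  cos_transform (sech_re t) x = pi / 4 * cosh (x / 2 * t) / cosh (x / 2 * (pi / 2)).
Proof.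
move=> ht; rewrite cos_transform_sech_re_scale // -(cos_transform_sech_re0 x).
by field; rewrite gt_eqF ?cosh_gt0.
Qed.

End SechFourier.

Section GaussTransform.
Variable R : realType.
Local Notation halfline := (`[(0 : R), +oo[%classic).
Local Notation C := R[i].
Local Notation Re := (@complex.Re R).
Implicit Types (f g q : R -> R) (z h : C) (a b w : R).

Definition exp_bounded g := measurable_fun halfline g /\
  exists G B, forall w, 0 <= w -> `|g w| <= G * expR (B * w).

Lemma expR_bound_ge0 g G B :
  (forall w, 0 <= w -> `|g w| <= G * expR (B * w)) -> 0 <= G.
Proof.
by move=> /(_ 0 (lexx 0)) /(le_trans (normr_ge0 _)); rewrite mulr0 expR0 mulr1.
Qed.

Lemma exp_bounded_le g G : measurable_fun halfline g ->
  (forall w, 0 <= w -> `|g w| <= G) -> exp_bounded g.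
Proof. by move=> mg gG; split => //; exists G, 0 => w w0; rewrite mul0r expR0 mulr1 gG. Qed.

Lemma exp_boundedZ a g : exp_bounded g -> exp_bounded (fun w => a * g w).
Proof.
move=> [mg [G [B gG]]]; split; first exact: measurable_funM.
by exists (`|a| * G), B => w w0; rewrite normrM -mulrA ler_wpM2l ?gG.
Qed.

Lemma exp_boundedD f g : exp_bounded f -> exp_bounded g ->
  exp_bounded (fun w => f w + g w).
Proof.
move=> [mf [F [A fF]]] [mg [G [B gG]]]; split; first exact: measurable_funD.
have F0 := expR_bound_ge0 fF; have G0 := expR_bound_ge0 gG.
exists (F + G), (Num.max A B) => w w0; apply: le_trans (ler_normD _ _) _.
rewrite mulrDl lerD //.
  by apply: le_trans (fF _ w0) _; rewrite ler_wpM2l // ler_expR ler_wpM2r // le_max lexx.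
by apply: le_trans (gG _ w0) _; rewrite ler_wpM2l // ler_expR ler_wpM2r // le_max lexx orbT.
Qed.

Lemma exprn_le_expR w n : 0 <= w -> w ^+ n <= n`!%:R * expR w.
Proof.
move=> w0; case: n => [|n]; first by rewrite fact0 mul1r; have := expR_ge1Dx w; lra.
by rewrite mulrC -ler_pdivrMr //; have := expR_ge1Dxn n w0; lra.
Qed.

Lemma exp_boundedX g n : exp_bounded g -> exp_bounded (fun w => w ^+ n * g w).
Proof.
move=> [mg [G [B gG]]]; split.
  by apply: measurable_funM => //; apply: measurable_funTS; exact: exprn_measurable.
exists (n`!%:R * G), (1 + B) => w w0; rewrite normrM mulrDl mul1r expRD mulrACA.
by rewrite ler_pM ?gG // ger0_norm ?exprn_ge0 // exprn_le_expR.
Qed.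

Lemma exp_bounded1 : exp_bounded (fun=> 1).
Proof. by apply: (@exp_bounded_le _ 1) => // w _; rewrite normr1. Qed.

Lemma exp_bounded_cos b : exp_bounded (fun w => cos (b * w)).
Proof.
apply: (@exp_bounded_le _ 1) => [|w _]; last exact: cos_max.
by apply: is_derive1_measurable => w; eexists; is_derive1_step.
Qed.

Lemma exp_bounded_sin b : exp_bounded (fun w => sin (b * w)).
Proof.
apply: (@exp_bounded_le _ 1) => [|w _]; last exact: sin_max.
by apply: is_derive1_measurable => w; eexists; is_derive1_step.
Qed.

Definition gauss_kernel z w : C := cexp (- z * (w ^+ 2)%:C).

Definition gauss_transform g z : C :=
  cintegral halfline (fun w => gauss_kernel z w * (g w)%:C).

Lemma normc_gauss_kernel z w : normc (gauss_kernel z w) = expR (- Re z * w ^+ 2).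
Proof. by rewrite normc_cexp ReMr ReN. Qed.

Lemma is_cderive_gauss_kernel z w :
  is_cderive (gauss_kernel z) w (gauss_kernel z w * (- z * (2 * w)%:C)).
Proof. by rewrite /gauss_kernel; is_cderive_calc; rewrite expr1 mulr1 mulr0 addr0. Qed.

Lemma gauss_cmeasurable g z : measurable_fun halfline g ->
  cmeasurable (fun w => gauss_kernel z w * (g w)%:C).
Proof.
move=> mg; apply: cmeasurableM; last exact: cmeasurable_real.
apply: ccontinuous_cmeasurable; apply: is_cderive_ccontinuous => w.
by eexists; exact: is_cderive_gauss_kernel.
Qed.

Lemma gauss_decay g z : 0 < Re z -> exp_bounded g ->
  exists K, exp_decay (fun w => gauss_kernel z w * (g w)%:C) K.
Proof.
move=> z0 [_ [G [B gG]]]; exists (G * expR ((B + 1) ^+ 2 / (4 * Re z))) => w w0.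
rewrite normcM normc_gauss_kernel normc_real.
apply: le_trans (ler_wpM2l (expR_ge0 _) (gG _ w0)) _.
have G0 := expR_bound_ge0 gG.
rewrite mulrCA -mulrA ler_wpM2l // -!expRD ler_expR -subr_ge0.
rewrite [leRHS](_ : _ = Re z * (w - (B + 1) / (2 * Re z)) ^+ 2).
  by rewrite mulr_ge0 ?sqr_ge0 // ltW.
by field; rewrite gt_eqF.
Qed.

Lemma gauss_cintegrable g z : 0 < Re z -> exp_bounded g ->
  cintegrable (fun w => gauss_kernel z w * (g w)%:C).
Proof.
move=> z0 eg; have [K gK] := gauss_decay z0 eg.
by apply: exp_decay_cintegrable gK; apply: gauss_cmeasurable; case: eg.
Qed.

Lemma gauss_transformZ a g z : 0 < Re z -> exp_bounded g ->
  gauss_transform (fun w => a * g w) z = a%:C * gauss_transform g z.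
Proof.
move=> z0 eg; rewrite -cintegralZ; last exact: gauss_cintegrable.
by apply: eq_cintegral => w; rewrite rmorphM mulrCA.
Qed.

Lemma gauss_transformD f g z : 0 < Re z -> exp_bounded f -> exp_bounded g ->
  gauss_transform (fun w => f w + g w) z = gauss_transform f z + gauss_transform g z.
Proof.
move=> z0 ef eg; rewrite -cintegralD; [|exact: gauss_cintegrable..].
by apply: eq_cintegral => w; rewrite rmorphD mulrDr.
Qed.

Lemma exp_bounded_sum (I : Type) (r : seq I) (F : I -> R -> R) :
  (forall i, exp_bounded (F i)) -> exp_bounded (fun w => \sum_(i <- r) F i w).
Proof.
move=> eF; elim: r => [|i r IH].
  rewrite (funext (fun w => big_nil _ _ _ _)).
  by apply: (@exp_bounded_le _ 0) => // w _; rewrite normr0.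
by rewrite (funext (fun w => big_cons _ _ _ _ _ _)) /=; exact: exp_boundedD.
Qed.

Lemma gauss_transform_sum (I : Type) (r : seq I) (F : I -> R -> R) z : 0 < Re z ->
  (forall i, exp_bounded (F i)) ->
  gauss_transform (fun w => \sum_(i <- r) F i w) z = \sum_(i <- r) gauss_transform (F i) z.
Proof.
move=> z0 eF; elim: r => [|i r IH].
  rewrite big_nil (funext (fun w => big_nil _ _ _ _)) -(mul0r (gauss_transform (fun=> 1) z)).
  by rewrite -(gauss_transformZ 0 z0 exp_bounded1); apply: eq_cintegral => w; rewrite mul0r.
rewrite big_cons (funext (fun w => big_cons _ _ _ _ _ _)) /= -IH.
by rewrite -gauss_transformD //; exact: exp_bounded_sum.
Qed.

Lemma gauss_remainder_decay g z : 0 < Re z -> exp_bounded g ->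
  exists2 K, 0 <= K & forall h, normc h < Re z / 2 ->
    exp_decay (fun w => gauss_kernel z w *
      (cexp (- h * (w ^+ 2)%:C) - 1 - (- h * (w ^+ 2)%:C)) * (g w)%:C) (K * normc h ^+ 2).
Proof.
move=> z0 eg; set a := Re z / 2.
have a0 : 0 < Re a%:C by rewrite /= divr_gt0.
have [K hK] := gauss_decay a0 (exp_boundedX 4 eg); exists K => [|h hz w w0].
  by have := le_trans (normc_ge0 _) (hK _ (lexx 0)); rewrite oppr0 expR0 mulr1.
have hw : normc (- h * (w ^+ 2)%:C) = normc h * w ^+ 2.
  by rewrite normcM normcN normc_real ger0_norm ?sqr_ge0.
have rem_le : normc (cexp (- h * (w ^+ 2)%:C) - 1 - (- h * (w ^+ 2)%:C)) <=
    normc h ^+ 2 * (w ^+ 4 * expR (normc h * w ^+ 2)).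
  apply: le_trans (normc_cexpB1x_le _) _.
  rewrite hw exprMn -mulrA -exprM ler_wpM2l ?sqr_ge0 // ler_wpM2l ?exprn_ge0 //.
  by rewrite ler_expR -hw normr_Re_le.
rewrite (_ : K * normc h ^+ 2 * expR (- w) = normc h ^+ 2 * (K * expR (- w))); last by ring.
apply: (le_trans _ (ler_wpM2l (sqr_ge0 (normc h)) (hK _ w0))).
rewrite !normcM !normc_gauss_kernel !normc_real normrM (ger0_norm (exprn_ge0 _ w0)).
apply: (@le_trans _ _ (expR (- Re z * w ^+ 2) *
    (normc h ^+ 2 * (w ^+ 4 * expR (normc h * w ^+ 2))) * `|g w|)).
  by rewrite ler_wpM2r // ler_wpM2l ?expR_ge0.
have exp_le : expR (- Re z * w ^+ 2) * expR (normc h * w ^+ 2) <= expR (- a * w ^+ 2).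
  by rewrite -expRD ler_expR -mulrDl ler_wpM2r ?sqr_ge0 //; rewrite /a in hz *; lra.
rewrite [leLHS](_ : _ = normc h ^+ 2 * (expR (- Re z * w ^+ 2) *
  expR (normc h * w ^+ 2) * (w ^+ 4 * `|g w|))); last by ring.
by rewrite ler_wpM2l ?sqr_ge0 // ler_wpM2r // mulr_ge0 ?exprn_ge0.
Qed.

Theorem is_derive_gauss_transform g z : 0 < Re z -> exp_bounded g ->
  is_derive (z : C^o) 1 (gauss_transform g : C^o -> C^o)
    (- gauss_transform (fun w => w ^+ 2 * g w) z).
Proof.
move=> z0 eg; have [K K0 hK] := gauss_remainder_decay z0 eg.
apply: (@is_derive1_quadratic C _ z _ K%:C (Re z / 2)%:C).
- by rewrite -[0]/(0%:C) ltcR divr_gt0.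
- by rewrite ler0c.
move=> h; rewrite !normr_complexE ltcR -rmorphXn -rmorphM lecR => hz.
have zh0 : 0 < Re (z + h).
  by have := normr_Re_le h; rewrite ReD ler_norml => /andP[]; lra.
have iz := gauss_cintegrable z0 eg; have izh := gauss_cintegrable zh0 eg.
have iz2 := gauss_cintegrable z0 (exp_boundedX 2 eg).
have -> : gauss_transform g (z + h) - gauss_transform g z
    - h * - gauss_transform (fun w => w ^+ 2 * g w) z =
    cintegral halfline (fun w => gauss_kernel z w *
      (cexp (- h * (w ^+ 2)%:C) - 1 - (- h * (w ^+ 2)%:C)) * (g w)%:C).
  rewrite mulrN opprK -[X in _ - X]mul1r -mulNr /gauss_transform.
  rewrite -!cintegralZ // -cintegralD //; last exact: cintegrableZ.
  rewrite -cintegralD //; last exact: cintegrableZ.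
    apply: eq_cintegral => w; rewrite /gauss_kernel opprD mulrDl cexpD rmorphM /=; ring.
  by apply: cintegrableD => //; exact: cintegrableZ.
apply: normc_cintegral_le (hK h hz); apply: cmeasurableM; last by apply: cmeasurable_real; case: eg.
apply: ccontinuous_cmeasurable; apply: is_cderive_ccontinuous => w.
by eexists; rewrite /gauss_kernel; is_cderive_step.
Qed.

Lemma gauss_transform_derive q (q' : R -> R) z : 0 < Re z ->
  exp_bounded q -> exp_bounded q' ->
  (forall w, is_derive w 1 q (q' w)) -> continuous q' ->
  gauss_transform q' z = 2 * z * gauss_transform (fun w => w * q w) z - (q 0)%:C.
Proof.
move=> z0 eq eq' dq cq'; have eqw : exp_bounded (fun w => w * q w) := exp_boundedX 1 eq.
have iq' := gauss_cintegrable z0 eq'; have iqw := gauss_cintegrable z0 eqw.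
pose F w := gauss_kernel z w * (q w)%:C.
pose f w := gauss_kernel z w * (q' w)%:C + - (2 * z) * (gauss_kernel z w * (w * q w)%:C).
have dF w : is_cderive F w (f w).
  apply: is_cderive_eq (is_cderiveM (is_cderive_gauss_kernel z w) (is_cderive_real (dq w))) _.
  by rewrite /f !rmorphM rmorph_nat; ring.
have [K1 FK] := gauss_decay z0 eq; have [K2 q'K] := gauss_decay z0 eq'.
have [K3 qwK] := gauss_decay z0 eqw.
have fK : exp_decay f (K2 + normc (- (2 * z)) * K3).
  move=> w w0; apply: le_trans (le_normcD _ _) _.
  by rewrite [leRHS]mulrDl lerD ?q'K // normcM -mulrA ler_wpM2l ?normc_ge0 ?qwK.
have cgauss : ccontinuous (gauss_kernel z).
  by apply: is_cderive_ccontinuous => w; eexists; exact: is_cderive_gauss_kernel.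
have cq : continuous q by move=> w; exact: is_derive1_continuous (dq w).
have cf : ccontinuous f.
  apply: (ccontinuousD (ccontinuousM cgauss (ccontinuous_real cq'))).
  apply: ccontinuousM; last apply: (ccontinuousM cgauss); last apply: ccontinuous_real.
    by apply: is_cderive_ccontinuous => w; eexists; exact: is_cderive_cst.
  by move=> w; apply: cvgM; [exact: cvg_id | exact: cq].
have := cintegral_derivative dF cf FK fK.
rewrite cintegralD //; last exact: cintegrableZ.
have -> : F 0 = (q 0)%:C by rewrite /F /gauss_kernel expr0n mulr0 cexp0 mul1r.
rewrite cintegralZ // => /(canRL (addrK _)) byparts.
by rewrite [LHS]byparts mulNr opprK addrC.
Qed.

Lemma gauss_transform1_1 : gauss_transform (fun=> 1) 1 = (Num.sqrt pi / 2)%:C.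
Proof.
rewrite /gauss_transform (@eq_cintegral _ _ _ (fun w => (gauss_fun w)%:C)) => [|w]; last first.
  by rewrite mulr1 /gauss_kernel mulN1r -rmorphN cexp_real.
by apply: complex_eq; rewrite /= /Rintegral ?integral0y_gauss ?integral0.
Qed.

Theorem gauss_transform1 z : 0 < Re z ->
  gauss_transform (fun=> 1) z = (Num.sqrt pi / 2)%:C / sqrtc z.
Proof.
move=> z0; pose f u := gauss_transform (fun=> 1) u * sqrtc u.
have f1 : f 1 = (Num.sqrt pi / 2)%:C by rewrite /f sqrtc1 mulr1 gauss_transform1_1.
suff f1z : f 1 = f z.
  by rewrite -f1 f1z /f mulfK //; exact/Re_gt0_neq0/Re_sqrtc_gt0.
have -> : f z = f (1 + 1%:C * (z - 1)) by rewrite mul1r addrC subrK.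
rewrite -[X in f X = _]addr0 -(mul0r (z - 1)).
apply: (is_cderive0_eq (f := fun s : R => f (1 + s%:C * (z - 1))) ler01) => s /andP[s0 s1].
set u := 1 + s%:C * (z - 1).
have u0 : 0 < Re u by rewrite /u !ReImE /= mul0r subr0; nra.
have sq0 : sqrtc u != 0 by exact/Re_gt0_neq0/Re_sqrtc_gt0.
have byparts : gauss_transform (fun=> 1) u = 2 * u * gauss_transform (fun w => w ^+ 2 * 1) u.
  have did w : is_derive w 1 (fun w : R => w ^+ 1 * 1) 1.
    by is_derive1_calc; rewrite mulr0 add0r !mul1r.
  rewrite (gauss_transform_derive u0 (exp_boundedX 1 exp_bounded1) exp_bounded1 did).
    have -> : (fun w : R => w * (w ^+ 1 * 1)) = (fun w => w ^+ 2 * 1).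
      by apply/funext => w; rewrite mulrA -exprS.
    by rewrite mulr1 expr1 subr0.
  by move=> w; exact: cvg_cst.
rewrite -(mul0r (z - 1)); apply: is_derive1_line.
apply: is_derive_eq (is_deriveM (is_derive_gauss_transform u0 exp_bounded1) (is_derive_sqrtc u0)) _.
by rewrite /GRing.scale /= byparts -{1}(sqr_sqrtc u); field.
Qed.

Lemma gauss_transform_mul_sin z b : 0 < Re z ->
  gauss_transform (fun w => w * sin (b * w)) z =
  (b / 2)%:C / z * gauss_transform (fun w => cos (b * w)) z.
Proof.
move=> z0; have zn0 := Re_gt0_neq0 z0.
have dsin w : is_derive w 1 (fun w => sin (b * w)) (b * cos (b * w)).
  by is_derive1_calc; ring.
have := gauss_transform_derive z0 (exp_bounded_sin b) (exp_boundedZ b (exp_bounded_cos b)) dsin.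
rewrite mulr0 sin0 subr0 (gauss_transformZ b z0 (exp_bounded_cos b)) => byparts.
have -> : (b / 2)%:C / z * gauss_transform (fun w => cos (b * w)) z =
    (2 * z)^-1 * (b%:C * gauss_transform (fun w => cos (b * w)) z).
  by rewrite rmorphM fmorphV rmorph_nat /=; field.
rewrite byparts ?mulKf ?mulf_neq0 ?pnatr_eq0 // => w.
apply: cvgM; first exact: cvg_cst.
have dcos : is_derive w 1 (fun w => cos (b * w)) (- (b * sin (b * w))).
  by is_derive1_calc; ring.
exact: is_derive1_continuous dcos.
Qed.

Lemma is_cderive_gauss_transform_cos z b : 0 < Re z ->
  is_cderive (fun b => gauss_transform (fun w => cos (b * w)) z) b
    (- gauss_transform (fun w => w * sin (b * w)) z).
Proof.
move=> z0; have ewsin c : exp_bounded (fun w => w * sin (c * w)) :=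
  exp_boundedX 1 (exp_bounded_sin c).
have [K1 K1P] := gauss_decay z0 exp_bounded1.
have [K2 K2P] := gauss_decay z0 (exp_boundedX 1 exp_bounded1).
have -> : - gauss_transform (fun w => w * sin (b * w)) z =
    cintegral halfline (fun w => - 1 * (gauss_kernel z w * (w * sin (b * w))%:C)).
  by rewrite cintegralZ ?mulN1r //; exact: gauss_cintegrable.
apply: (is_cderive_cintegral (f := fun b w => gauss_kernel z w * (cos (b * w))%:C)
  (u := b - 1) (v := b + 1) (K := K1) (L := K2)
  (f' := fun b w => - 1 * (gauss_kernel z w * (w * sin (b * w))%:C))).
- by apply/andP; split; lra.
- move=> c _; split; first by apply: gauss_cmeasurable; case: (exp_bounded_cos c).
  move=> w w0; apply: le_trans (K1P w w0); rewrite !normcM !normc_real.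
  by rewrite ler_wpM2l ?normc_ge0 // normr1 cos_max.
- move=> c w _; is_cderive_calc.
  have -> : - sin (c * w) * (c * 0 + w * 1) = - (w * sin (c * w)) by ring.
  by rewrite rmorphN; ring.
- move=> c _ w w0; apply: le_trans (K2P w w0).
  rewrite mulN1r normcN !normcM !normc_real !normrM.
  by rewrite ler_wpM2l ?normc_ge0 // normr1 ler_wpM2l ?sin_max.
Qed.

Theorem gauss_transform_cos z b : 0 < Re z ->
  gauss_transform (fun w => cos (b * w)) z =
  (Num.sqrt pi / 2)%:C / sqrtc z * cexp (- (b ^+ 2 / 4)%:C / z).
Proof.
move=> z0; wlog b0 : b / 0 <= b => [hw|].
  have [/hw//|/ltW b0] := leP 0 b; rewrite -sqrrN -hw ?oppr_ge0 //.
  by apply: eq_cintegral => w; rewrite mulNr cosN.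
pose f c := gauss_transform (fun w => cos (c * w)) z * cexp ((c ^+ 2 / 4)%:C / z).
have f0 : f 0 = (Num.sqrt pi / 2)%:C / sqrtc z.
  rewrite /f expr0n mul0r mul0r cexp0 mulr1 -gauss_transform1 //.
  by apply: eq_cintegral => w; rewrite mul0r cos0.
suff -> : (Num.sqrt pi / 2)%:C / sqrtc z = f b.
  by rewrite /f -mulrA mulNr (mulrC (cexp _)) cexpNK mulr1.
rewrite -f0; apply: is_cderive0_eq b0 _ => c _; rewrite /f.
have dG := is_cderive_gauss_transform_cos c z0; is_cderive_calc.
rewrite gauss_transform_mul_sin //.
have -> : c ^+ 2 * 0 + 4^-1 * (2 * c ^+ 2.-1 * 1) = c / 2 by rewrite /= expr1; field.
by ring.
Qed.

End GaussTransform.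

Section BoundedKernelFubini.
Variable R : realType.
Local Notation mu := (@lebesgue_measure R).
Implicit Types (f k W : R -> R) (b : R * R -> R).

Lemma integrable_mul_le1 (d : measure_display) (T : measurableType d)
    (m : {measure set T -> \bar R}) (f b : T -> R) :
  m.-integrable setT (EFin \o f) -> measurable_fun setT b -> (forall x, `|b x| <= 1) ->
  m.-integrable setT (EFin \o (fun x => f x * b x)).
Proof.
move=> fi mb b1.
have mf : measurable_fun setT f by apply/measurable_EFinP; exact: measurable_int fi.
apply: (le_integrable _ _ _ fi) => //.
  by apply/measurable_EFinP; exact: measurable_funM.
by move=> x _ /=; rewrite lee_fin normrM ler_piMr.
Qed.

Lemma integrable_prod_mul f g : mu.-integrable setT (EFin \o f) ->
  mu.-integrable setT (EFin \o g) ->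
  (mu \x mu)%E.-integrable setT (fun x : R * R => (f x.1 * g x.2)%:E).
Proof.
move=> fi gi.
have mf : measurable_fun setT f by apply/measurable_EFinP; exact: measurable_int fi.
have mg : measurable_fun setT g by apply/measurable_EFinP; exact: measurable_int gi.
apply/integrable12ltyP => /=.
  by apply/measurable_EFinP; apply: measurable_funM; exact: measurableT_comp.
have inner u : (\int[mu]_w `|f u * g w|%:E = `|f u|%:E * \int[mu]_w `|g w|%:E)%E.
  rewrite -ge0_integralZl_EFin //.
    by apply: eq_integral => w _; rewrite normrM EFinM.
  by apply/measurable_EFinP; exact: measurableT_comp.
under eq_integral do rewrite inner.
have /integrableP[_ f_fin] := fi; have /integrableP[_ g_fin] := gi.
have gfin : (\int[mu]_w `|g w|%:E)%E \is a fin_num by rewrite ge0_fin_numE ?integral_ge0.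
rewrite -(fineK gfin) ge0_integralZr //.
- by rewrite fineK // lte_mul_pinfty ?integral_ge0 // ge0_fin_numE ?integral_ge0.
- by apply/measurable_EFinP; exact: measurableT_comp.
- by rewrite fineK // integral_ge0.
Qed.

Lemma Rintegral_Fubini (F : R * R -> R) : (mu \x mu)%E.-integrable setT (EFin \o F) ->
  (forall u, mu.-integrable setT (EFin \o (fun w => F (u, w)))) ->
  (forall w, mu.-integrable setT (EFin \o (fun u => F (u, w)))) ->
  \int[mu]_u \int[mu]_w F (u, w) = \int[mu]_w \int[mu]_u F (u, w).
Proof.
move=> Fi Fu Fw.
have inner1 u : ((\int[mu]_w F (u, w))%:E = \int[mu]_w (F (u, w))%:E)%E.
  by rewrite fineK // integrable_fin_num //; exact: Fu.
have inner2 w : ((\int[mu]_u F (u, w))%:E = \int[mu]_u (F (u, w))%:E)%E.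
  by rewrite fineK // integrable_fin_num //; exact: Fw.
transitivity (fine (\int[mu]_u \int[mu]_w (F (u, w))%:E)%E).
  by congr fine; apply: eq_integral => u _.
rewrite (Fubini Fi); congr fine; apply: eq_integral => w _.
by rewrite -inner2.
Qed.

Lemma Rintegral_Fubini_le1 k W b : mu.-integrable setT (EFin \o k) ->
  mu.-integrable setT (EFin \o W) -> measurable_fun setT b -> (forall x, `|b x| <= 1) ->
  \int[mu]_u (k u * \int[mu]_w (W w * b (u, w))) =
  \int[mu]_w (W w * \int[mu]_u (k u * b (u, w))).
Proof.
move=> ki Wi mb b1; pose F x := k x.1 * W x.2 * b x.
have Fi : (mu \x mu)%E.-integrable setT (EFin \o F).
  exact: (integrable_mul_le1 (integrable_prod_mul ki Wi)).
have Wbi u : mu.-integrable setT (EFin \o (fun w => W w * b (u, w))).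
  apply: (integrable_mul_le1 Wi) => //.
  by apply: measurableT_comp => //; exact: measurable_pair1.
have kbi w : mu.-integrable setT (EFin \o (fun u => k u * b (u, w))).
  apply: (integrable_mul_le1 ki) => //.
  by apply: measurableT_comp => //; exact: measurable_pair2.
have FuE u : (fun w => F (u, w)) = (fun w => k u * (W w * b (u, w))).
  by apply/funext => w; rewrite /F mulrA.
have FwE w : (fun u => F (u, w)) = (fun u => W w * (k u * b (u, w))).
  by apply/funext => u; rewrite /F (mulrC (k _)) mulrA.
transitivity (\int[mu]_u \int[mu]_w F (u, w)).
  by apply: eq_Rintegral => u _; rewrite FuE RintegralZl.
rewrite Rintegral_Fubini //.
- by apply: eq_Rintegral => w _; rewrite FwE RintegralZl.
- by move=> u; rewrite FuE; refine (integrableZl _ (k u) (Wbi u)).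
- by move=> w; rewrite FwE; refine (integrableZl _ (W w) (kbi w)).
Qed.

Lemma Rintegral_mkcond_mul (D : set R) k f :
  \int[mu]_(u in D) (k u * f u) = \int[mu]_u ((k \_ D) u * f u).
Proof.
rewrite Rintegral_mkcond; congr (Rintegral _ _ _); apply/funext => u.
by rewrite /patch; case: ifP; rewrite ?mul0r.
Qed.

Lemma Rintegral_Fubini_le1_in (D E : set R) k W b : measurable D -> measurable E ->
  mu.-integrable D (EFin \o k) -> mu.-integrable E (EFin \o W) ->
  measurable_fun setT b -> (forall x, `|b x| <= 1) ->
  \int[mu]_(u in D) (k u * \int[mu]_(w in E) (W w * b (u, w))) =
  \int[mu]_(w in E) (W w * \int[mu]_(u in D) (k u * b (u, w))).
Proof.
move=> mD mE ki Wi mb b1.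
have ext (A : set R) f : measurable A -> mu.-integrable A (EFin \o f) ->
    mu.-integrable setT (EFin \o (f \_ A)).
  by move=> mA fi; rewrite -restrict_EFin; refine ((integrable_mkcond _ _).1 fi).
rewrite [LHS]Rintegral_mkcond_mul [RHS]Rintegral_mkcond_mul.
under eq_Rintegral do rewrite (Rintegral_mkcond_mul E).
under [RHS]eq_Rintegral do rewrite (Rintegral_mkcond_mul D).
exact: (Rintegral_Fubini_le1 (ext _ _ mD ki) (ext _ _ mE Wi)).
Qed.

End BoundedKernelFubini.

Section GaussParseval.
Variable R : realType.
Local Notation mu := (@lebesgue_measure R).
Local Notation halfline := (`[(0 : R), +oo[%classic).
Local Notation C := R[i].
Local Notation Re := (@complex.Re R).
Local Notation Im := (@complex.Im R).
Implicit Types (k W : R -> R) (z : C) (a b c u w t : R).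

Lemma Rintegral_cos_transform k W c :
  mu.-integrable halfline (EFin \o k) -> mu.-integrable halfline (EFin \o W) ->
  \int[mu]_(u in halfline) (k u * cos_transform W (c * u)) =
  \int[mu]_(w in halfline) (W w * \int[mu]_(u in halfline) (k u * cos (c * w * u))).
Proof.
move=> ki Wi; pose b (x : R * R) := cos (c * x.1 * x.2).
have mb : measurable_fun setT b.
  apply: (@measurableT_comp _ _ _ _ _ _ (@cos R)).
    by apply: continuous_measurable_fun; exact: continuous_cos.
  by apply: measurable_funM => //; exact: measurable_funM.
have mH : measurable halfline by [].
have swap := Rintegral_Fubini_le1_in mH mH ki Wi mb (fun x => cos_max _).
transitivity (\int[mu]_(u in halfline) (k u *
    \int[mu]_(w in halfline) (W w * b (u, w)))).
  by apply: eq_Rintegral => u _; congr (_ * _); apply: eq_Rintegral => w _; rewrite mulrC.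
rewrite swap; apply: eq_Rintegral => w _; congr (_ * _); apply: eq_Rintegral => u _.
by rewrite /b /= (mulrAC c w).
Qed.

Lemma gauss_transform_cos_transform_swap W z c : 0 < Re z ->
  mu.-integrable halfline (EFin \o W) ->
  gauss_transform (fun u => cos_transform W (c * u)) z =
  cintegral halfline (fun w => gauss_transform (fun u => cos (c * w * u)) z * (W w)%:C).
Proof.
move=> z0 Wi; have [kRe kIm] := gauss_cintegrable z0 (@exp_bounded1 R).
apply: complex_eq.
  transitivity (\int[mu]_(u in halfline)
      (Re (gauss_kernel z u * 1%:C) * cos_transform W (c * u))).
    by apply: eq_Rintegral => u _; rewrite mulr1 ReMr.
  rewrite (Rintegral_cos_transform _ kRe Wi); apply: eq_Rintegral => w _.
  rewrite ReMr mulrC; congr (_ * _); apply: eq_Rintegral => u _.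
  by rewrite mulr1 ReMr.
transitivity (\int[mu]_(u in halfline)
    (Im (gauss_kernel z u * 1%:C) * cos_transform W (c * u))).
  by apply: eq_Rintegral => u _; rewrite mulr1 ImMr.
rewrite (Rintegral_cos_transform _ kIm Wi); apply: eq_Rintegral => w _.
rewrite ImMr mulrC; congr (_ * _); apply: eq_Rintegral => u _.
by rewrite mulr1 ImMr.
Qed.

Theorem gauss_transform_cos_transform W z c : 0 < Re z ->
  mu.-integrable halfline (EFin \o W) -> exp_bounded W -> c != 0 ->
  gauss_transform (fun u => cos_transform W (c * u)) z =
  (Num.sqrt pi / 2)%:C / sqrtc z * gauss_transform W (((c / 2) ^+ 2)%:C / z).
Proof.
move=> z0 Wi eW c0; rewrite gauss_transform_cos_transform_swap // -cintegralZ.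
  apply: eq_cintegral => w; rewrite gauss_transform_cos // mulrA; congr (_ * cexp _ * _).
  have -> : (c * w) ^+ 2 / 4 = (c / 2) ^+ 2 * w ^+ 2 by field.
  by rewrite !mulNr rmorphM /= [in RHS]mulrAC.
apply: gauss_cintegrable eW; apply: divc_Re_gt0 z0.
by rewrite exprn_even_gt0 // mulf_neq0 // invr_eq0 pnatr_eq0.
Qed.

Definition cosh_ratio a b u : R := cosh (a * u) / cosh (b * u).

Lemma exp_bounded_cosh_ratio a b : exp_bounded (cosh_ratio a b).
Proof.
split.
  apply: is_derive1_measurable => w; eexists; rewrite /cosh_ratio; is_derive1_step.
  by rewrite gt_eqF ?cosh_gt0.
exists 1, `|a| => w w0; rewrite mul1r ger0_norm ?divr_ge0 ?(ltW (cosh_gt0 _)) //.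
apply: le_trans (cosh_le_expR_normM a w0).
by rewrite ler_piMr ?(ltW (cosh_gt0 _)) // invf_le1 ?cosh_ge1 ?cosh_gt0.
Qed.

Lemma sech_angle_lt a b : `|a| < b -> `|pi * a / (2 * b)| < pi / 2.
Proof.
move=> ab; have b0 : 0 < b by exact: le_lt_trans ab.
rewrite normrM normfV normrM (gtr0_norm (pi_gt0 R)) [`|2 * b|]gtr0_norm ?mulr_gt0 //.
by rewrite invfM mulrA mulrAC ltr_pM2r ?invr_gt0 // ltr_pdivrMr // ltr_pM2l ?pi_gt0.
Qed.

Lemma cos_transform_sech_re_cosh_ratio a b u : `|a| < b ->
  cos_transform (sech_re (pi * a / (2 * b))) (4 * b / pi * u) = pi / 4 * cosh_ratio a b u.
Proof.
move=> ab; have b0 : 0 < b by exact: le_lt_trans ab.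
rewrite (cos_transform_sech_re _ (sech_angle_lt ab)) /cosh_ratio.
move: (pi : R) (pi_gt0 R) => q q0.
have -> : 4 * b / q * u / 2 * (q * a / (2 * b)) = a * u by field; rewrite !gt_eqF.
have -> : 4 * b / q * u / 2 * (q / 2) = b * u by field; rewrite !gt_eqF.
by rewrite mulrA.
Qed.

Lemma exp_bounded_sech_re t : 0 < cos t -> exp_bounded (sech_re t).
Proof.
move=> c0; apply: (exp_bounded_le (G := 2 / cos t) (measurable_sech_re c0)) => w w0.
apply: le_trans (normr_sech_re_le c0 w0) _; rewrite ler_piMr ?divr_ge0 ?(ltW c0) //.
by rewrite -[leRHS]expR0 ler_expR oppr_le0.
Qed.

Theorem gauss_transform_cosh_ratio a b z : `|a| < b -> 0 < Re z ->
  gauss_transform (cosh_ratio a b) z = (2 / Num.sqrt pi)%:C / sqrtc z *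
    gauss_transform (sech_re (pi * a / (2 * b))) (((2 * b / pi) ^+ 2)%:C / z).
Proof.
move=> ab z0; have b0 : 0 < b by exact: le_lt_trans ab.
have pi0 := pi_gt0 R; have c0 := cos_gt0_normr (sech_angle_lt ab).
have sechi : mu.-integrable halfline (EFin \o sech_re (pi * a / (2 * b))).
  by apply: integrable_le_expN (measurable_sech_re c0) _ => w; exact: normr_sech_re_le.
have c_neq0 : 4 * b / pi != 0 by rewrite gt_eqF // divr_gt0 // mulr_gt0.
have := gauss_transform_cos_transform z0 sechi (exp_bounded_sech_re c0) c_neq0.
rewrite (funext (fun u => cos_transform_sech_re_cosh_ratio u ab)).
rewrite (gauss_transformZ _ z0 (exp_bounded_cosh_ratio a b)).
have -> : 4 * b / pi / 2 = 2 * b / pi by rewrite mulrAC; congr (_ / _); field.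
move=> parseval; have pi4 : (pi / 4)%:C != 0 :> C.
  by rewrite real_complex_neq0 gt_eqF // divr_gt0.
apply: (mulfI pi4); rewrite parseval !mulrA -rmorphM; congr (_%:C / _ * _).
have sqrtpi0 : Num.sqrt pi != 0 :> R by rewrite gt_eqF // sqrtr_gt0.
by rewrite -[X in _ = X / 4 * _](sqr_sqrtr (ltW pi0)); move: (Num.sqrt _) sqrtpi0 => q q0; field.
Qed.

End GaussParseval.

Section DualKernel.
Variable R : realType.
Implicit Types y w th : R.

Lemma cosh3Dcos3 y th : cosh (3 * y) + cos (3 * th) =
  (cosh y + cos th) * (4 * (cosh y ^+ 2 - cosh y * cos th + cos th ^+ 2) - 3).
Proof. by rewrite cosh3 cos3; ring. Qed.

Lemma cos_pi3B_subD th :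
  cos (pi / 3 - th) - cos (pi / 3 + th) = Num.sqrt 3 * sin th.
Proof. by rewrite cosB cosD sin_pi3; field. Qed.

Lemma cos_pi3B_mulD th :
  cos (pi / 3 - th) * cos (pi / 3 + th) = 1 / 4 - sin th ^+ 2.
Proof.
have r2 : Num.sqrt 3 ^+ 2 = 3 :> R by rewrite sqr_sqrtr.
transitivity ((cos th ^+ 2 - Num.sqrt 3 ^+ 2 * sin th ^+ 2) / 4).
  by rewrite cosB cosD cos_pi3 sin_pi3; field.
by rewrite r2 cos2sin2; field.
Qed.

Lemma cos3_factor th :
  cos (3 * th) = 4 * cos th * (cos (pi / 3 - th) * cos (pi / 3 + th)).
Proof. by rewrite cos_pi3B_mulD cos3 sin2cos2; field. Qed.

Lemma cosh12Dcos6_gt0 th w : cos (3 * th) != 0 -> 0 < cosh (12 * w) + cos (6 * th).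
Proof.
move=> c3; have -> : 6 * th = 2 * (3 * th) by ring.
rewrite (mulr_natl (3 * th)) cos_mulr2n.
have : 0 < cos (3 * th) ^+ 2 by rewrite exprn_even_gt0.
by have := cosh_ge1 (12 * w); lra.
Qed.

Definition dual_kernel th w : R := sech_re (pi / 3 - th) w - sech_re (pi / 3 + th) w.

Lemma dual_kernelE th w : cos (3 * th) != 0 ->
  (cosh (12 * w) + cos (6 * th)) * dual_kernel th w =
  2 * Num.sqrt 3 * (sin th * cosh (10 * w) - sin (5 * th) * cosh (2 * w)).
Proof.
rewrite cos3_factor => c3; rewrite /dual_kernel !sech_reE.
have := cos_pi3B_mulD th; have := cos_pi3B_subD th; move: c3.
move: (cos (pi / 3 - th)) (cos (pi / 3 + th)) => n m c3 nBm nMm.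
have [n0 m0] : n != 0 /\ m != 0.
  by split; apply: contraNneq c3 => ->; rewrite ?mul0r !mulr0.
have sqrD_gt0 x : x != 0 -> 0 < sinh (2 * w) ^+ 2 + x ^+ 2.
  by move=> x0; rewrite ltr_wpDl ?sqr_ge0 // exprn_even_gt0.
have [Dn Dm] := (sqrD_gt0 _ n0, sqrD_gt0 _ m0).
have -> : 12 * w = 3 * (2 * (2 * w)) by ring.
have -> : 6 * th = 3 * (2 * th) by ring.
have -> : 10 * w = 5 * (2 * w) by ring.
rewrite cosh3Dcos3 cosh5 sin5 cosh_mul2 cos_mul2.
have := cosh2Bsinh2 (2 * w); move: Dn Dm.
move: (cosh (2 * w)) (sinh (2 * w)) (sin th) nBm nMm => c s S nBm nMm Dn Dm.
move=> /(canRL (subrK _)) c2.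
have -> : 4 * ((2 * c ^+ 2 - 1) ^+ 2 - (2 * c ^+ 2 - 1) * (1 - 2 * S ^+ 2)
    + (1 - 2 * S ^+ 2) ^+ 2) - 3 = 16 * ((s ^+ 2 + n ^+ 2) * (s ^+ 2 + m ^+ 2)).
  have -> : (s ^+ 2 + n ^+ 2) * (s ^+ 2 + m ^+ 2) =
      s ^+ 2 ^+ 2 + s ^+ 2 * ((n - m) ^+ 2 + 2 * (n * m)) + (n * m) ^+ 2 by ring.
  by rewrite nBm nMm (exprMn _ (Num.sqrt 3)) sqr_sqrtr // c2; field.
have -> : c * n / (s ^+ 2 + n ^+ 2) - c * m / (s ^+ 2 + m ^+ 2) =
    c * ((n - m) * (s ^+ 2 - n * m)) / ((s ^+ 2 + n ^+ 2) * (s ^+ 2 + m ^+ 2)).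
  by field; rewrite !gt_eqF.
have := mulf_neq0 (lt0r_neq0 Dn) (lt0r_neq0 Dm); rewrite nBm nMm.
move: (_ * (s ^+ 2 + m ^+ 2)) => D D0.
have -> : s ^+ 2 = c ^+ 2 - 1 by rewrite c2; ring.
by field.
Qed.

End DualKernel.

Section Telescoping.
Variable R : realType.
Variables (al be a : R).

Definition alt_sin (k : nat) : R := (-1) ^+ k * sin (k%:R * al).
Definition cosh_shift (k : nat) : R := cosh (a - k%:R * be).

Lemma alt_sin_rec k : alt_sin k.+2 = - (2 * cos al * alt_sin k.+1 + alt_sin k).
Proof.
rewrite /alt_sin -(natr1 k.+1) -(natr1 k) !mulrDl !mul1r.
rewrite (sinD (_ + al) al) (_ : k%:R * al = k%:R * al + al - al) ?(sinB _ al); last by ring.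
by rewrite !exprS subrK; ring.
Qed.

Lemma cosh_shift0 : cosh_shift 0 = cosh a.
Proof. by rewrite /cosh_shift mul0r subr0. Qed.

Lemma cosh_shift_rec k :
  cosh_shift k.+2 = 2 * cosh be * cosh_shift k.+1 - cosh_shift k.
Proof.
rewrite /cosh_shift -(natr1 k.+1); set x := a - k.+1%:R * be.
have -> : a - (k.+1%:R + 1) * be = x - be by rewrite /x; ring.
have -> : a - k%:R * be = x + be by rewrite /x -(natr1 k); ring.
by have := coshDB x be; lra.
Qed.

Lemma sum_alt_sin_cosh_shift m :
  2 * (cosh be + cos al) * (\sum_(k < m) alt_sin k.+1 * cosh_shift k.+1) =
  alt_sin 1 * cosh_shift 0 - alt_sin m.+1 * cosh_shift m + alt_sin m * cosh_shift m.+1.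
Proof.
elim: m => [|m IH].
  by rewrite big_ord0 /alt_sin mul0r sin0; ring.
by rewrite big_ord_recr mulrDr IH alt_sin_rec cosh_shift_rec /=; ring.
Qed.

End Telescoping.

Lemma ltn_double_ell (p j : nat) : (0 < j <= ell p)%N -> (2 * j < p)%N.
Proof. by rewrite /ell; lia. Qed.

Section MordellKernel.
Variable R : realType.
Implicit Types (u w : R).

Variable p : nat.

Definition mordell_angle (j : nat) : R := pi * j%:R / p%:R.

Definition kernel_freqD (j : nat) : R :=
  if (6 * j < p)%N then 4 * p%:R + 12 * j%:R else 8 * p%:R - 12 * j%:R.

Definition kernel_freqB (j : nat) : R := 4 * p%:R - 12 * j%:R.

Definition mordell_kernel (j : nat) u : R :=
  (-1) ^+ (6 * j < p)%N * cosh_ratio (kernel_freqD j) (6 * p%:R) u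
  + cosh_ratio (kernel_freqB j) (6 * p%:R) u.

Lemma mordell_kernelE j u : mordell_kernel j u =
  2 * cosh (2 * p%:R * u) / cosh (6 * p%:R * u) * cosh_shift (12 * u) (6 * p%:R * u) j
  - (if (6 * j < p)%N then 2 * cosh_shift (12 * u) (2 * p%:R * u) j else 0).
Proof.
have c0 : cosh (6 * p%:R * u) != 0 by rewrite gt_eqF // cosh_gt0.
rewrite /mordell_kernel /kernel_freqD /kernel_freqB /cosh_ratio /cosh_shift.
have sum1 : cosh ((8 * p%:R - 12 * j%:R) * u) + cosh ((4 * p%:R - 12 * j%:R) * u) =
    2 * (cosh (6 * p%:R * u - j%:R * (12 * u)) * cosh (2 * p%:R * u)).
  by rewrite -coshDB; congr (cosh _ + cosh _); ring.
have sum2 : cosh ((8 * p%:R - 12 * j%:R) * u) + cosh ((4 * p%:R + 12 * j%:R) * u) =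
    2 * (cosh (6 * p%:R * u) * cosh (2 * p%:R * u - j%:R * (12 * u))).
  by rewrite -coshDB; congr (cosh _ + cosh _); ring.
case: ifP => _.
  rewrite expr1 mulN1r -mulNr -mulrDl (_ : - cosh _ + cosh _ =
      2 * (cosh (6 * p%:R * u - j%:R * (12 * u)) * cosh (2 * p%:R * u)) -
      2 * (cosh (6 * p%:R * u) * cosh (2 * p%:R * u - j%:R * (12 * u)))).
    by field.
  by rewrite -sum1 -sum2; ring.
by rewrite expr0 mul1r -mulrDl sum1 subr0; field.
Qed.

Lemma exp_bounded_mordell_kernel j : exp_bounded (mordell_kernel j).
Proof.
apply: exp_boundedD (exp_bounded_cosh_ratio _ _).
exact: exp_boundedZ (exp_bounded_cosh_ratio _ _).
Qed.

Hypothesis p_coprime6 : coprime 6 p.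

Lemma coprime6_mod : (p %% 6 = 1 \/ p %% 6 = 5)%N.
Proof.
move: p_coprime6; rewrite -coprime_modr.
have : (p %% 6 < 6)%N by rewrite ltn_mod.
by case: (p %% 6)%N => [|[|[|[|[|[|]]]]]] //; [left | right].
Qed.

Lemma coprime6_gt0 : (0 < p)%N.
Proof. by have := coprime6_mod; lia. Qed.

Lemma coprime6_ellE : p = (2 * ell p).+1.
Proof. by have := coprime6_mod; rewrite /ell; lia. Qed.

Variables (j : nat) (w : R).
Local Notation th := (mordell_angle j).

Let p_neq0 : p%:R != 0 :> R.
Proof. by rewrite pnatr_eq0 -lt0n coprime6_gt0. Qed.

Let pthE : p%:R * th = j%:R * pi.
Proof. by rewrite /mordell_angle mulrC divfK // mulrC. Qed.

(* The reflection [k -> p - k] is a symmetry of the summand, so the two upper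
   boundary terms cancel. *)
Lemma sum_full_period :
  2 * (cosh (12 * w) + cos (6 * th)) *
    (\sum_(k < ell p) alt_sin (6 * th) k.+1 * cosh_shift (12 * w) (6 * p%:R * w) k.+1) =
  alt_sin (6 * th) 1 * cosh (6 * p%:R * w).
Proof.
set l := ell p; have pE : p%:R = 2 * l%:R + 1 :> R.
  by rewrite {1}coprime6_ellE -natr1 natrM.
have alt_sinE : alt_sin (6 * th) l.+1 = alt_sin (6 * th) l.
  rewrite /alt_sin (_ : l.+1%:R * (6 * th) = - (l%:R * (6 * th)) + (6 * j)%:R * pi); last first.
    have -> : (6 * j)%:R * pi = 6 * (p%:R * th) :> R by rewrite pthE natrM mulrA.
    by rewrite pE -natr1; ring.
  by rewrite sinDnpi -[(-1) ^+ (6 * j)]signr_odd oddM expr0 sinN exprS; ring.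
have cosh_shiftE : cosh_shift (12 * w) (6 * p%:R * w) l.+1 =
    cosh_shift (12 * w) (6 * p%:R * w) l.
  by rewrite /cosh_shift -coshN pE -natr1; congr cosh; ring.
by rewrite sum_alt_sin_cosh_shift alt_sinE cosh_shiftE subrK cosh_shift0.
Qed.

Lemma short_sum_boundary :
  let m := (p %/ 6)%N in
  alt_sin (6 * th) m.+1 * cosh_shift (12 * w) (2 * p%:R * w) m
  - alt_sin (6 * th) m * cosh_shift (12 * w) (2 * p%:R * w) m.+1 =
  (-1) ^+ ((p + 3) %/ 6 + j) * (sin th * cosh (10 * w) - sin (5 * th) * cosh (2 * w)).
Proof.
move=> m; set r := (p %% 6)%N.
have pE : p%:R = 6 * m%:R + r%:R :> R by rewrite -natrM -natrD mulnC -divn_eq.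
have mth : m%:R * (6 * th) = - (r%:R * th) + j%:R * pi by rewrite -pthE pE; ring.
have alt_sin_m : alt_sin (6 * th) m = - ((-1) ^+ (m + j) * sin (r%:R * th)).
  by rewrite /alt_sin mth sinDnpi sinN exprD; ring.
have alt_sin_m1 : alt_sin (6 * th) m.+1 = - ((-1) ^+ (m + j) * sin ((6 - r%:R) * th)).
  rewrite /alt_sin -natr1 mulrDl mul1r mth.
  rewrite (_ : _ + 6 * th = (6 - r%:R) * th + j%:R * pi) ?sinDnpi; last by ring.
  by rewrite exprD exprS; ring.
have cosh_shift_m : cosh_shift (12 * w) (2 * p%:R * w) m = cosh (2 * r%:R * w).
  by rewrite /cosh_shift pE; congr cosh; ring.
have cosh_shift_m1 : cosh_shift (12 * w) (2 * p%:R * w) m.+1 = cosh ((12 - 2 * r%:R) * w).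
  by rewrite /cosh_shift -coshN pE -natr1; congr cosh; ring.
rewrite alt_sin_m alt_sin_m1 cosh_shift_m cosh_shift_m1.
have [r1|r5] := coprime6_mod.
  have -> : ((p + 3) %/ 6 = m)%N by rewrite /m; lia.
  have -> : r%:R = 1 :> R by rewrite /r r1.
  have -> : (12 - 2 * 1) * w = 10 * w by ring.
  have -> : (6 - 1) * th = 5 * th by ring.
  by rewrite mulr1 mul1r; ring.
have -> : ((p + 3) %/ 6 = m.+1)%N by rewrite /m; lia.
have -> : r%:R = 5 :> R by rewrite /r r5.
have -> : (12 - 2 * 5) * w = 2 * w by ring.
have -> : (6 - 5) * th = th by ring.
have -> : 2 * 5 * w = 10 * w by ring.
by rewrite addSn exprS; ring.
Qed.

Lemma sum_mordell_kernel :
  (cosh (12 * w) + cos (6 * th)) *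
    (\sum_(k < ell p) alt_sin (6 * th) k.+1 * mordell_kernel k.+1 w) =
  (-1) ^+ ((p + 3) %/ 6 + j) * (sin th * cosh (10 * w) - sin (5 * th) * cosh (2 * w)).
Proof.
rewrite -short_sum_boundary; set m := (p %/ 6)%N; set Q := cosh _ + _.
set S := \sum_(k < m) alt_sin (6 * th) k.+1 * cosh_shift (12 * w) (2 * p%:R * w) k.+1.
have short : \sum_(k < ell p) alt_sin (6 * th) k.+1 *
    (if (6 * k.+1 < p)%N then 2 * cosh_shift (12 * w) (2 * p%:R * w) k.+1 else 0) = 2 * S.
  have m_le : (m <= ell p)%N by rewrite /m /ell; lia.
  rewrite mulr_sumr (big_ord_widen (ell p) (fun k => 2 * (alt_sin (6 * th) k.+1 *
    cosh_shift (12 * w) (2 * p%:R * w) k.+1))) // [RHS]big_mkcond; apply: eq_bigr => k _ /=.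
  rewrite (_ : (6 * k.+1 < p)%N = (k < m)%N); last by have := coprime6_mod; rewrite /m; lia.
  by case: ifP => _; rewrite ?mulr0 // mulrCA.
have cosh_neq0 : cosh (6 * p%:R * w) != 0 by rewrite gt_eqF ?cosh_gt0.
have full := sum_full_period; have telescope := sum_alt_sin_cosh_shift (6 * th) (12 * w)
  (2 * p%:R * w) m; rewrite -/Q -/S in full telescope.
set T := (X in 2 * Q * X) in full.
have -> : \sum_(k < ell p) alt_sin (6 * th) k.+1 * mordell_kernel k.+1 w =
    2 * cosh (2 * p%:R * w) / cosh (6 * p%:R * w) * T - 2 * S.
  rewrite -short mulr_sumr -sumrB; apply: eq_bigr => k _.
  by rewrite mordell_kernelE; ring.
transitivity (cosh (2 * p%:R * w) / cosh (6 * p%:R * w) * (2 * Q * T) - 2 * Q * S).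
  by field.
rewrite full telescope cosh_shift0.
by field.
Qed.

Lemma dual_kernel_mordell : cos (3 * th) != 0 ->
  dual_kernel th w = 2 * Num.sqrt 3 * (-1) ^+ ((p + 3) %/ 6 + j) *
    \sum_(k < ell p) alt_sin (6 * th) k.+1 * mordell_kernel k.+1 w.
Proof.
move=> c3; apply: (mulfI (lt0r_neq0 (cosh12Dcos6_gt0 w c3))).
rewrite dual_kernelE // [RHS]mulrCA sum_mordell_kernel.
by rewrite -[RHS]mulrA signrMK.
Qed.

End MordellKernel.

Section MordellDuality.
Variable R : realType.
Local Notation C := R[i].
Local Notation Re := (@complex.Re R).
Implicit Types (w : R) (z : C).
Variable p : nat.
Hypothesis p_coprime6 : coprime 6 p.

Let p_gt0 : 0 < p%:R :> R.
Proof. by rewrite ltr0n coprime6_gt0. Qed.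

Section Index.
Variable j : nat.
Hypothesis j_range : (0 < j <= ell p)%N.
Local Notation th := (mordell_angle R p j).

Let j_gt0 : 0 < j%:R :> R.
Proof. by rewrite ltr0n; case/andP: j_range. Qed.

Let j2_lt_p : 2 * j%:R < p%:R :> R.
Proof. by rewrite -natrM ltr_nat ltn_double_ell. Qed.

Lemma kernel_freqD_lt : `|kernel_freqD R p j| < 6 * p%:R.
Proof.
have j0 := j_gt0; have j2p := j2_lt_p.
rewrite /kernel_freqD ltr_norml; case: ifPn => h.
  have : 6 * j%:R < p%:R :> R by rewrite -natrM ltr_nat.
  by move=> ?; apply/andP; split; lra.
have : p%:R < 6 * j%:R :> R.
  by rewrite -natrM ltr_nat; have := coprime6_mod p_coprime6; lia.
by move=> ?; apply/andP; split; lra.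
Qed.

Lemma kernel_freqB_lt : `|kernel_freqB R p j| < 6 * p%:R.
Proof.
have j0 := j_gt0; have j2p := j2_lt_p.
by rewrite /kernel_freqB ltr_norml; apply/andP; split; lra.
Qed.

Lemma kernel_freqD_angle : pi * kernel_freqD R p j / (2 * (6 * p%:R)) =
  if (6 * j < p)%N then pi / 3 + th else pi - (pi / 3 + th).
Proof.
have p0 := lt0r_neq0 p_gt0.
by rewrite /kernel_freqD /mordell_angle; case: ifP => _; field.
Qed.

Lemma kernel_freqB_angle : pi * kernel_freqB R p j / (2 * (6 * p%:R)) = pi / 3 - th.
Proof.
have p0 := lt0r_neq0 p_gt0.
by rewrite /kernel_freqB /mordell_angle; field.
Qed.

Lemma dual_kernel_sech_re w : dual_kernel th w =
  (-1) ^+ (6 * j < p)%N * sech_re (pi * kernel_freqD R p j / (2 * (6 * p%:R))) w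
  + sech_re (pi * kernel_freqB R p j / (2 * (6 * p%:R))) w.
Proof.
rewrite kernel_freqD_angle kernel_freqB_angle /dual_kernel addrC; congr (_ + _).
case: ifP => _; first by rewrite mulN1r.
by rewrite mul1r !sech_reE cosBpi sqrrN mulrN mulNr.
Qed.

Lemma cos3_angle_neq0 : cos (3 * th) != 0.
Proof.
have := cos_gt0_normr (sech_angle_lt kernel_freqD_lt).
have := cos_gt0_normr (sech_angle_lt kernel_freqB_lt).
rewrite kernel_freqD_angle kernel_freqB_angle cos3_factor => cosB_gt0 cosD_gt0.
have cosD_neq0 : cos (pi / 3 + th) != 0.
  move: cosD_gt0; case: ifP => _; first by move/lt0r_neq0.
  by rewrite cosBpi => /lt0r_neq0; rewrite oppr_eq0.
have cos_neq0 : cos th != 0.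
  have pi0 := pi_gt0 R.
  have th_gt0 : 0 < th by rewrite divr_gt0 // mulr_gt0.
  apply/lt0r_neq0/cos_gt0_normr; rewrite gtr0_norm // /mordell_angle ltr_pdivrMr //.
  by rewrite mulrAC ltr_pdivlMr // -mulrA ltr_pM2l // mulrC.
by rewrite !mulf_neq0 // lt0r_neq0.
Qed.

Theorem gauss_transform_mordell_kernel z : 0 < Re z ->
  gauss_transform (mordell_kernel p j) z = (2 / Num.sqrt pi)%:C / sqrtc z *
    gauss_transform (dual_kernel th) (((12 * p%:R / pi) ^+ 2)%:C / z).
Proof.
move=> z0; rewrite (_ : 12 * p%:R = 2 * (6 * p%:R)); last by ring.
set b : R := 6 * p%:R; have b_gt0 : 0 < b by rewrite mulr_gt0.
have z'0 : 0 < Re (((2 * b / pi) ^+ 2)%:C / z).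
  by apply: divc_Re_gt0 z0; rewrite exprn_gt0 // divr_gt0 ?pi_gt0 // mulr_gt0.
have bounded_sech a : `|a| < b -> exp_bounded (sech_re (pi * a / (2 * b)) : R -> R).
  by move=> ab; exact: exp_bounded_sech_re (cos_gt0_normr (sech_angle_lt ab)).
have [freqD_lt freqB_lt] := (kernel_freqD_lt, kernel_freqB_lt).
rewrite (funext dual_kernel_sech_re) -/b.
rewrite (gauss_transformD z'0 (exp_boundedZ _ (bounded_sech _ freqD_lt)) (bounded_sech _ freqB_lt)).
rewrite (gauss_transformZ _ z'0 (bounded_sech _ freqD_lt)) /mordell_kernel -/b.
have bounded_ratio a : exp_bounded (cosh_ratio a b) by exact: exp_bounded_cosh_ratio.
rewrite (gauss_transformD z0 (exp_boundedZ _ (bounded_ratio _)) (bounded_ratio _)).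
rewrite (gauss_transformZ _ z0 (bounded_ratio _)).
rewrite (gauss_transform_cosh_ratio freqD_lt z0) (gauss_transform_cosh_ratio freqB_lt z0).
by rewrite [RHS]mulrDr [X in _ = X + _]mulrCA.
Qed.

End Index.

Lemma dual_kernel_mixing (i : 'I_(ell p)) w :
  dual_kernel (mordell_angle R p i.+1) w = Num.sqrt (3 * p%:R) *
    \sum_(k < ell p) mixing_mx R p i k * mordell_kernel p k.+1 w.
Proof.
have i_range : (0 < i.+1 <= ell p)%N by rewrite ltn_ord.
rewrite (dual_kernel_mordell p_coprime6 _ (cos3_angle_neq0 i_range)).
rewrite -mulrA !mulr_sumr; apply: eq_bigr => k _.
have sqrtp : Num.sqrt p%:R != 0 :> R by rewrite gt_eqF // sqrtr_gt0.
rewrite mxE /alt_sin sqrtrM //.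
rewrite (_ : k.+1%:R * (6 * mordell_angle R p i.+1) = 6 * i.+1%:R * k.+1%:R * pi / p%:R).
  by rewrite !exprD; field.
by rewrite /mordell_angle; ring.
Qed.

End MordellDuality.

Section MordellAppellIntegrals.
Variable R : realType.
Local Notation halfline := (`[(0 : R), +oo[%classic).
Local Notation C := R[i].
Local Notation Re := (@complex.Re R).
Implicit Types (P a b c u : R) (t : C).

Definition sinh_ratio P a u : R := sinh ((P - a) * u) / sinh (P * u).

Lemma JS_gauss_transform (P a : int) t :
  JS P a t = t^-1 * gauss_transform (sinh_ratio P%:~R a%:~R) ((P%:~R : R)%:C / t).
Proof.
have integrandE (u : R) : cexp (- (P%:~R * u ^+ 2)%:C / t) *
    (sinh ((P - a)%:~R * u) / sinh (P%:~R * u))%:C =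
    gauss_kernel ((P%:~R : R)%:C / t) u * (sinh_ratio P%:~R a%:~R u)%:C.
  by rewrite /sinh_ratio intrB /gauss_kernel rmorphM /= !mulNr mulrAC.
by rewrite /JS (eq_cintegral _ integrandE).
Qed.

Lemma normr_sinh_ratio_le1 P a u : 0 <= P -> 0 <= a <= 2 * P -> 0 <= u ->
  `|sinh_ratio P a u| <= 1.
Proof.
move=> P0 /andP[a0 aP] u0.
have S0 : 0 <= sinh (P * u) by rewrite sinh_ge0 // mulr_ge0.
have num_le : `|sinh ((P - a) * u)| <= sinh (P * u).
  rewrite ler_norml -sinhN; apply/andP; split; apply: ler_sinh.
    by rewrite -mulNr ler_wpM2r //; lra.
  by rewrite ler_wpM2r //; lra.
rewrite /sinh_ratio normrM normfV (ger0_norm S0).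
have [->|Sn] := eqVneq (sinh (P * u)) 0; first by rewrite invr0 mulr0.
by rewrite ler_pdivrMr ?mul1r // lt_neqAle eq_sym Sn.
Qed.

Lemma exp_bounded_sinh_ratio P a : 0 <= P -> 0 <= a <= 2 * P ->
  exp_bounded (sinh_ratio P a).
Proof.
move=> P0 aP; apply: (exp_bounded_le (G := 1)) => [|u]; last exact: normr_sinh_ratio_le1.
have msinh c : measurable_fun halfline (fun u => sinh (c * u)).
  by apply: is_derive1_measurable => u; eexists; is_derive1_step.
have mpow : measurable_fun halfline (fun u => sinh (P * u) `^ (-1)).
  by apply: (@measurableT_comp _ _ _ _ _ _ (fun x : R => x `^ (-1))); first exact: measurable_powR.
apply: eq_measurable_fun (measurable_funM (msinh (P - a)) mpow) => u.
rewrite inE /= in_itv /= andbT => u0; rewrite powR_inv1 //.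
by rewrite sinh_ge0 // mulr_ge0.
Qed.

Lemma sinh_ratio_reflect P a u : sinh_ratio P (2 * P - a) u = - sinh_ratio P a u.
Proof. by rewrite /sinh_ratio -mulNr -sinhN; congr (sinh _ / _); ring. Qed.

Lemma sinh_ratio_add b c u : 0 < b -> 0 < u ->
  sinh_ratio (2 * b) (b - c) u + sinh_ratio (2 * b) (b + c) u = cosh_ratio c b u.
Proof.
move=> b0 u0; have sinh_neq0 := lt0r_neq0 (sinh_gt0 (mulr_gt0 b0 u0)).
rewrite /sinh_ratio -mulrDl.
have -> : (2 * b - (b - c)) * u = b * u + c * u by ring.
have -> : (2 * b - (b + c)) * u = b * u - c * u by ring.
have -> : 2 * b * u = b * u + b * u by ring.
have := cosh_gt0 (b * u); rewrite sinhDB (sinhD (b * u) (b * u)) /cosh_ratio.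
move: (sinh (b * u)) sinh_neq0 (cosh (b * u)) => s s0 k k0.
by rewrite (_ : s * k + k * s = 2 * s * k); [field; rewrite s0 gt_eqF | ring].
Qed.

Lemma JS_reflect (P a : int) t : 0 < P -> 0 <= a <= 2 * P -> 0 < Re t ->
  JS P (2 * P - a) t = - JS P a t :> C.
Proof.
move=> P0 aP t0; have P0R : 0 < P%:~R :> R by rewrite ltr0z.
have aPR : 0 <= (a%:~R : R) <= 2 * P%:~R.
  by rewrite -(intrM _ 2) ler0z ler_int.
have ratioE : sinh_ratio P%:~R (2 * P - a)%:~R = (fun u : R => -1 * sinh_ratio P%:~R a%:~R u).
  by apply/funext => u; rewrite mulN1r -sinh_ratio_reflect intrB intrM.
rewrite !JS_gauss_transform ratioE gauss_transformZ; first by rewrite rmorphN1 mulN1r mulrN.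
  exact: divc_Re_gt0.
by apply: exp_bounded_sinh_ratio aPR; exact: ltW.
Qed.

Lemma JS_add (b c : int) t : 0 < b -> `|c| <= b -> 0 < Re t ->
  JS (2 * b) (b - c) t + JS (2 * b) (b + c) t =
  t^-1 * gauss_transform (cosh_ratio c%:~R b%:~R) ((2 * b%:~R : R)%:C / t).
Proof.
move=> b0; rewrite ler_norml => /andP[cb1 cb2] t0; have b0R : 0 < b%:~R :> R by rewrite ltr0z.
rewrite !JS_gauss_transform -mulrDr intrM intrB intrD.
set z := _ / t; have z0 : 0 < Re z by apply: divc_Re_gt0 => //; rewrite mulr_gt0.
have bounded_ratio x : - b%:~R <= x <= b%:~R -> exp_bounded (sinh_ratio (2 * b%:~R) (b%:~R + x)).
  by move=> /andP[? ?]; apply: exp_bounded_sinh_ratio; [lra | apply/andP; split; lra].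
have cbR : - b%:~R <= (c%:~R : R) <= b%:~R by rewrite -intrN !ler_int cb1.
have boundedB : exp_bounded (sinh_ratio (2 * b%:~R) (b%:~R - c%:~R) : R -> R).
  by apply: bounded_ratio; have /andP[? ?] := cbR; apply/andP; split; lra.
have boundedD := bounded_ratio _ cbR.
rewrite -(gauss_transformD z0 boundedB boundedD); congr (_ * _).
apply: eq_cintegral_gt0 => [||u u0]; last by rewrite sinh_ratio_add.
  exact: gauss_cintegrable (exp_boundedD boundedB boundedD).
exact: gauss_cintegrable (exp_bounded_cosh_ratio _ _).
Qed.

Lemma derivable_JS (P a : int) t : 0 < P -> 0 <= a <= 2 * P -> 0 < Re t ->
  derivable (JS P a : C^o -> C^o) t 1.
Proof.
move=> P0 aP t0; have P0R : 0 < P%:~R :> R by rewrite ltr0z.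
have aPR : 0 <= (a%:~R : R) <= 2 * P%:~R by rewrite -(intrM _ 2) ler0z ler_int.
rewrite (funext (JS_gauss_transform P a)).
have dV : derivable ((fun t => t^-1) : C^o -> C^o) t 1.
  by apply: derivableV; [exact: Re_gt0_neq0 | exact: derivable_id].
have dPV : derivable ((fun t => (P%:~R : R)%:C / t) : C^o -> C^o) t 1.
  by apply: derivable1M dV; exact: derivable_cst.
apply: (derivable1M dV (derivable1_comp dPV _)).
have bounded_ratio := exp_bounded_sinh_ratio (ltW P0R) aPR.
by case: (is_derive_gauss_transform (divc_Re_gt0 P0R t0) bounded_ratio).
Qed.

End MordellAppellIntegrals.

Section MordellVector.
Variable R : realType.
Local Notation C := R[i].
Local Notation Re := (@complex.Re R).
Implicit Types t : C.
Variable p : nat.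
Hypothesis p_coprime6 : coprime 6 p.

Let p_gt0 : (0 < p)%N.
Proof. exact: coprime6_gt0. Qed.

Let pR_gt0 : 0 < p%:R :> R.
Proof. by rewrite ltr0n. Qed.

Lemma calL_root_argE t : (48 * Posz p)%:~R * t / pi%:C = (48 * p%:R / pi)%:C * t.
Proof.
have -> : (48 * Posz p)%:~R = (48 * p%:R : R)%:C :> C.
  by rewrite intrM rmorphM /= -!pmulrn !rmorph_nat.
by rewrite [in RHS]rmorphM fmorphV /=; ring.
Qed.

Lemma holomorphic_calL_coord (j : nat) : (0 < j <= ell p)%N ->
  holomorphic_on [set t : C | 0 < Re t] (fun t => calL_coord (Posz p) (Posz j) t).
Proof.
move=> j_range t /= t0.
have j2 := ltn_double_ell j_range.
have dJS a : 0 <= a <= 2 * (12 * Posz p) -> derivable (JS (12 * Posz p) a : C^o -> C^o) t 1.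
  by move=> ha; apply: derivable_JS => //; lia.
have dcst (c : C) : derivable ((fun=> c) : C^o -> C^o) t 1 by exact: derivable_cst.
apply: derivable1M.
  have droot : derivable ((fun t => (48 * Posz p)%:~R * t / pi%:C) : C^o -> C^o) t 1.
    by apply: derivable1M (dcst _); apply: derivable1M (dcst _) _; exact: derivable_id.
  apply: (derivable1_comp droot).
  have : 0 < Re ((48 * Posz p)%:~R * t / pi%:C).
    by rewrite calL_root_argE mulrC ReMr mulr_gt0 // divr_gt0 ?pi_gt0 // mulr_gt0.
  by move=> /is_derive_sqrtc[].
apply: derivableD; last by apply: dJS; lia.
apply: derivableD; last by apply: dJS; lia.
apply: derivableD; last by apply: dJS; lia.
by apply: derivable1M (dcst _) _; apply: dJS; lia.
Qed.

Lemma JS_add_6p (c : int) t : `|c| <= 6 * Posz p -> 0 < Re t ->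
  JS (12 * Posz p) (6 * Posz p - c) t + JS (12 * Posz p) (6 * Posz p + c) t =
  t^-1 * gauss_transform (cosh_ratio c%:~R (6 * p%:R)) ((12 * p%:R)%:C / t).
Proof.
move=> cp t0; have b0 : 0 < 6 * Posz p by lia.
have -> : 12 * Posz p = 2 * (6 * Posz p) by lia.
have -> : 12 * p%:R = 2 * (6 * p%:R) :> R by ring.
by rewrite (JS_add b0 cp t0) intrM -!pmulrn.
Qed.

Lemma JS_kernel_freqD (j : nat) t : (0 < j <= ell p)%N -> 0 < Re t ->
  (Num.sg (6 * Posz j - Posz p))%:~R * JS (12 * Posz p) `|12 * Posz j - 2 * Posz p| t
    + JS (12 * Posz p) (14 * Posz p - 12 * Posz j) t =
  t^-1 * gauss_transform (fun u => (-1) ^+ (6 * j < p)%N *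
    cosh_ratio (kernel_freqD R p j) (6 * p%:R) u) ((12 * p%:R)%:C / t).
Proof.
move=> j_range t0; have j2 := ltn_double_ell j_range.
have z0 : 0 < Re ((12 * p%:R)%:C / t) by apply: divc_Re_gt0; rewrite // mulr_gt0.
rewrite (gauss_transformZ _ z0 (exp_bounded_cosh_ratio _ _)) /kernel_freqD; case: ifP => h.
  have -> : Num.sg (6 * Posz j - Posz p) = -1 by apply: ltr0_sg; lia.
  have := @JS_add_6p (4 * Posz p + 12 * Posz j) t; rewrite intrD !intrM -!pmulrn.
  move=> addE.
  have -> : `|12 * Posz j - 2 * Posz p| = 6 * Posz p - (4 * Posz p + 12 * Posz j) by lia.
  have -> : 14 * Posz p - 12 * Posz j =
      2 * (12 * Posz p) - (6 * Posz p + (4 * Posz p + 12 * Posz j)) by lia.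
  rewrite JS_reflect; [|lia..|by []].
  by rewrite expr1 !rmorphN1 !mulN1r mulrN -addE ?opprD //; lia.
have -> : Num.sg (6 * Posz j - Posz p) = 1.
  by apply: gtr0_sg; have := coprime6_mod p_coprime6; lia.
have := @JS_add_6p (8 * Posz p - 12 * Posz j) t; rewrite intrB !intrM -!pmulrn.
move=> addE.
have -> : `|12 * Posz j - 2 * Posz p| = 6 * Posz p - (8 * Posz p - 12 * Posz j) by lia.
have -> : 14 * Posz p - 12 * Posz j = 6 * Posz p + (8 * Posz p - 12 * Posz j) by lia.
by rewrite expr0 !rmorph1 !mul1r addE //; lia.
Qed.

Lemma calL_coordE (j : nat) t : (0 < j <= ell p)%N -> 0 < Re t ->
  calL_coord (Posz p) (Posz j) t = sqrtc ((48 * p%:R / pi)%:C * t) *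
    (t^-1 * gauss_transform (mordell_kernel p j) ((12 * p%:R)%:C / t)).
Proof.
move=> j_range t0; have j2 := ltn_double_ell j_range.
have z0 : 0 < Re ((12 * p%:R)%:C / t) by apply: divc_Re_gt0; rewrite // mulr_gt0.
have bounded_ratio a := exp_bounded_cosh_ratio a (6 * p%:R : R).
have freqB_le : `|4 * Posz p - 12 * Posz j| <= 6 * Posz p by lia.
rewrite /calL_coord calL_root_argE (JS_kernel_freqD j_range t0) -addrA; congr (_ * _).
have -> : 12 * Posz j + 2 * Posz p = 6 * Posz p - (4 * Posz p - 12 * Posz j) by lia.
have -> : 10 * Posz p - 12 * Posz j = 6 * Posz p + (4 * Posz p - 12 * Posz j) by lia.
rewrite (JS_add_6p freqB_le t0) /mordell_kernel /kernel_freqB intrB !intrM -!pmulrn -mulrDr.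
by rewrite -(gauss_transformD z0 (exp_boundedZ _ (bounded_ratio _)) (bounded_ratio _)).
Qed.

Lemma gauss_transform_dual_kernel (i : 'I_(ell p)) (z : C) : 0 < Re z ->
  gauss_transform (dual_kernel (mordell_angle R p i.+1)) z = (Num.sqrt (3 * p%:R))%:C *
    \sum_(k < ell p) (mixing_mx R p i k)%:C * gauss_transform (mordell_kernel p k.+1) z.
Proof.
move=> z0; have eM k : exp_bounded (mordell_kernel p k) := exp_bounded_mordell_kernel R p k.
have eMZ (k : 'I_(ell p)) : exp_bounded (fun w => mixing_mx R p i k * mordell_kernel p k.+1 w).
  exact: exp_boundedZ (eM _).
rewrite (funext (dual_kernel_mixing p_coprime6 i)).
rewrite (gauss_transformZ _ z0 (exp_bounded_sum _ eMZ)) (gauss_transform_sum _ z0 eMZ).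
by congr (_ * _); apply: eq_bigr => k _; exact: gauss_transformZ z0 (eM _).
Qed.

Lemma calL_modular_factor t : 0 < Re t ->
  sqrtc ((48 * p%:R / pi)%:C * t) / t *
    ((2 / Num.sqrt pi)%:C / sqrtc ((12 * p%:R)%:C / t) * (Num.sqrt (3 * p%:R))%:C) =
  sqrtc (pi%:C / t) *
    (sqrtc ((48 * p%:R / pi)%:C * (pi%:C ^+ 2 / t)) / (pi%:C ^+ 2 / t)).
Proof.
move=> t0; have pi0 := pi_gt0 R.
set c : R := 48 * p%:R / pi; have c0 : 0 < c by rewrite divr_gt0 // mulr_gt0.
have s12 : Num.sqrt (12 * p%:R) = 2 * Num.sqrt (3 * p%:R) :> R.
  have -> : 12 * p%:R = 2 ^+ 2 * (3 * p%:R) :> R by ring.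
  by rewrite (sqrtrM _ (sqr_ge0 2)) sqrtr_sqr ger0_norm.
have p12 : 0 < 12 * p%:R :> R by rewrite mulr_gt0.
rewrite (sqrtc_mulr c0 t0) (sqrtc_divr p12 t0) s12 (sqrtc_divr pi0 t0).
have -> : c%:C * (pi%:C ^+ 2 / t) = (c * pi ^+ 2)%:C / t by rewrite mulrA -rmorphXn -rmorphM.
have cpi2 : 0 < c * pi ^+ 2 by rewrite mulr_gt0 ?exprn_gt0.
rewrite (sqrtc_divr cpi2 t0) (sqrtrM _ (ltW c0)) sqrtr_sqr (gtr0_norm pi0).
have pi_sqrtE : pi%:C = (Num.sqrt pi)%:C ^+ 2 :> C by rewrite -rmorphXn sqr_sqrtr // ltW.
have pi_neq0 : (Num.sqrt pi)%:C != 0 :> C by rewrite real_complex_neq0 // gt_eqF // sqrtr_gt0.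
have p_neq0 : (Num.sqrt (3 * p%:R))%:C != 0 :> C.
  by rewrite real_complex_neq0 // gt_eqF // sqrtr_gt0 mulr_gt0.
have := Re_gt0_neq0 (Re_sqrtc_gt0 t0); have := sqr_sqrtc t.
move: (sqrtc t) => s; rewrite !(rmorphM, fmorphV, rmorph_nat) /= pi_sqrtE => <- s_neq0.
move: pi_neq0 p_neq0 s_neq0.
move: (Num.sqrt pi)%:C (Num.sqrt (3 * p%:R))%:C => rpi rp rpi0 rp0 s0.
by field; rewrite s0 rpi0 rp0.
Qed.

Lemma calL_coord_modular (i : 'I_(ell p)) t : 0 < Re t ->
  calL_coord (Posz p) (Posz i.+1) t = sqrtc (pi%:C / t) *
    \sum_(k < ell p) (mixing_mx R p i k)%:C *
      calL_coord (Posz p) (Posz k.+1) (pi%:C ^+ 2 / t).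
Proof.
move=> t0; have p12 : 0 < 12 * p%:R :> R by rewrite mulr_gt0.
have range (k : 'I_(ell p)) : (0 < k.+1 <= ell p)%N by rewrite ltn_ord.
have t'0 : 0 < Re (pi%:C ^+ 2 / t).
  by rewrite -rmorphXn; apply: divc_Re_gt0; rewrite ?exprn_gt0 ?pi_gt0.
have dual_argE : ((12 * p%:R / pi) ^+ 2)%:C / ((12 * p%:R)%:C / t) =
    (12 * p%:R)%:C / (pi%:C ^+ 2 / t).
  have p12C : (12 * p%:R)%:C != 0 :> C by rewrite real_complex_neq0 gt_eqF.
  have piC : pi%:C != 0 :> C by rewrite real_complex_neq0 gt_eqF ?pi_gt0.
  rewrite rmorphXn rmorphM fmorphV /=; have := Re_gt0_neq0 t0.
  move: (12 * p%:R)%:C pi%:C p12C piC => q z q0 z0 t_neq0.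
  by field; rewrite q0 z0 t_neq0.
rewrite (calL_coordE (range i) t0).
rewrite (gauss_transform_mordell_kernel p_coprime6 (range i) (divc_Re_gt0 p12 t0)) dual_argE.
rewrite (gauss_transform_dual_kernel _ (divc_Re_gt0 p12 t'0)).
have regroup (x y z w S : C) : x * (y * (z * (w * S))) = x * y * (z * w) * S by ring.
rewrite regroup (calL_modular_factor t0) -[LHS]mulrA !mulr_sumr.
apply: eq_bigr => k _; rewrite (calL_coordE (range k) t'0).
by ring.
Qed.

End MordellVector.

Lemma prime_ge5_coprime6 (p : nat) : prime p -> (5 <= p)%N -> coprime 6 p.
Proof.
move=> p_prime p_ge5; rewrite (coprimeMl p 2 3) !prime_coprime // !dvdn_prime2 //.
by apply/andP; split; lia.
Qed.

Theorem proposition2p6 (R : realType) (p : nat) (p_prime : prime p)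
    (p_ge5 : (5 <= p)%N) :
  (forall i : 'I_(ell p),
     holomorphic_on [set t : R[i] | 0 < complex.Re t]
       (fun t => calL p t i ord0))
  /\
  (forall t : R[i], 0 < complex.Re t ->
     calL p t =
       sqrtc (pi%:C / t) *:
         (map_mx (real_complex R) (mixing_mx R p) *m calL p (pi%:C ^+ 2 / t))).
Proof.
have p_coprime6 := prime_ge5_coprime6 p_prime p_ge5.
have range (i : 'I_(ell p)) : (0 < i.+1 <= ell p)%N by rewrite ltn_ord.
split=> [i|t t0].
  rewrite (_ : (fun t => calL p t i ord0) = calL_coord (Posz p) (Posz i.+1)).
    exact: holomorphic_calL_coord (range i).
  by apply/funext => t; rewrite mxE.
apply/colP => i; rewrite !mxE (calL_coord_modular p_coprime6 i t0).
by congr (_ * _); apply: eq_bigr => k _; rewrite !mxE.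
Qed.
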